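(* Let $a,b>-2$, let $N\ge2$ be even, $w(x)=(1-x)^{a/2}(1+x)^{b/2}$ on $[-1,1]$, and let $f\in C^1[-1,1]$ be real-valued with $f(-1)=f(1)=0$. Define $$G_N^{(1)}(f)=\frac{\int_{[-1,1]^N}\prod_{1\le j<k\le N}|x_j-x_k|\prod_{j=1}^N w(x_j)(1+f(x_j))\,dx_j}{\int_{[-1,1]^N}\prod_{1\le j<k\le N}|x_j-x_k|\prod_{j=1}^N w(x_j)\,dx_j}.$$ For $j\ge0$ let $\varphi_j^{(1)}(x)=\frac{P_j^{(a+1,b+1)}(x)}{\sqrt{h_j^{(a+1,b+1)}}}(1-x)^{a/2}(1+x)^{b/2}$, let $S_N^{(1)}$ be the integral operator on $L^2[-1,1]$ with kernel $S_N^{(1)}(x,y)=\sum_{j=0}^{N-1}(1-x^2)\varphi_j^{(1)}(x)\varphi_j^{(1)}(y)$, and let $$C_N^{(1)}=\sqrt{\frac{N(N+a+1)(N+b+1)(N+a+b+2)}{(2N+a+b+1)(2N+a+b+3)}}.$$ Then $\left[G_N^{(1)}(f)\right]^2=\det(I+T_{\mathrm{JOE}})$, where $$T_{\mathrm{JOE}}=S_N^{(1)}(f^2+2f)-S_N^{(1)}\varepsilon f'-S_N^{(1)}f\varepsilon f'+C_N^{(1)}\big(\varepsilon\varphi_N^{(1)}\big)\otimes\varphi_{N-1}^{(1)}(f^2+2f)$$ $$\qquad+C_N^{(1)}\big(\varepsilon\varphi_N^{(1)}\big)\otimes\big(\varepsilon\varphi_{N-1}^{(1)}\big)f'-C_N^{(1)}\big(\varepsilon\varphi_N^{(1)}\big)\otimes\varphi_{N-1}^{(1)}f\varepsilon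 f'.$$
   Context: $P_j^{(\alpha,\beta)}$ is the Jacobi polynomial of degree $j$ (Szegő normalization) with $\int_{-1}^1P_j^{(\alpha,\beta)}P_k^{(\alpha,\beta)}(1-x)^{\alpha}(1+x)^{\beta}dx=h_j^{(\alpha,\beta)}\delta_{jk}$, $h_j^{(\alpha,\beta)}=\frac{2^{\alpha+\beta+1}\Gamma(j+\alpha+1)\Gamma(j+\beta+1)}{j!(2j+\alpha+\beta+1)\Gamma(j+\alpha+\beta+1)}$. $\varepsilon$ is the integral operator with kernel $\varepsilon(x,y)=\frac12\mathrm{sgn}(x-y)$ on $[-1,1]$. In $T_{\mathrm{JOE}}$, $f$, $f'$ and $f^2+2f$ denote the corresponding multiplication operators, products of operators are compositions (e.g. $S_N^{(1)}f\varepsilon f'=S_N^{(1)}\circ M_f\circ\varepsilon\circ M_{f'}$), and for functions $u,v$, $u\otimes v$ is the rank-one operator with kernel $u(x)v(y)$. $\det$ is the Fredholm determinant on $L^2[-1,1]$. *)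

(* Defs.v *)
From HB Require Import structures.
From mathcomp Require Import all_boot all_order all_algebra.
From mathcomp Require Import all_classical all_reals all_analysis.
Set Implicit Arguments. Unset Strict Implicit. Unset Printing Implicit Defensive.
Import Order.TTheory GRing.Theory Num.Theory.
Import numFieldNormedType.Exports.
Local Open Scope classical_set_scope.
Local Open Scope ring_scope.

Section Defs.
Variable R : realType.

Definition int11 (g : R -> R) : R :=
  \int[@lebesgue_measure R]_(x in `[(-1)%R, 1%R]) g x.

Fixpoint nint (n : nat) (F : seq R -> R) : R :=
  match n with
  | 0%N => F [::]
  | n'.+1 => int11 (fun x => nint n' (fun s => F (x :: s)))
  end.

Definition gbinom (z : R) (k : nat) : R :=
  (\prod_(i < k) (z - i%:R)) / (k`!)%:R.

(* Jacobi polynomial P_n^{(al,be)} (Szego normalization, explicit formula) *)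
Definition jacobiP (al be : R) (n : nat) (x : R) : R :=
  \sum_(s < n.+1) gbinom (n%:R + al) (n - s) * gbinom (n%:R + be) s
     * ((x - 1) / 2) ^+ s * ((x + 1) / 2) ^+ (n - s).

Definition jweight (al be : R) (x : R) : R := powR (1 - x) al * powR (1 + x) be.

Definition jacobi_h (al be : R) (j : nat) : R :=
  int11 (fun x => (jacobiP al be j x) ^+ 2 * jweight al be x).

Definition phi1 (a b : R) (j : nat) (x : R) : R :=
  jacobiP (a + 1) (b + 1) j x / Num.sqrt (jacobi_h (a + 1) (b + 1) j)
    * powR (1 - x) (a / 2) * powR (1 + x) (b / 2).

Definition SN1 (a b : R) (N : nat) (x y : R) : R :=
  \sum_(j < N) (1 - x ^+ 2) * phi1 a b j x * phi1 a b j y.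

Definition CN1 (a b : R) (N : nat) : R :=
  let n := N%:R in
  Num.sqrt (n * (n + a + 1) * (n + b + 1) * (n + a + b + 2)
            / ((2 * n + a + b + 1) * (2 * n + a + b + 3))).

Definition kernel := R -> R -> R.
Definition epsk : kernel := fun x y => Num.sg (x - y) / 2.
Definition epsf (g : R -> R) (x : R) : R := int11 (fun y => epsk x y * g y).
Definition kcomp (K L : kernel) : kernel := fun x y => int11 (fun z => K x z * L z y).
(* K o M_h  (M_h = multiplication by h) *)
Definition kmulr (K : kernel) (h : R -> R) : kernel := fun x y => K x y * h y.
Definition tensor (u v : R -> R) : kernel := fun x y => u x * v y.

(* Fredholm determinant det(I+K) on L^2[-1,1] via the Fredholm series *)
Definition fredholm_det (K : kernel) : R :=
  limn (series (fun n : nat =>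
     (n`!)%:R^-1 * nint n (fun s => \det (\matrix_(i < n, j < n) K (s`_i) (s`_j))))).

Definition vdm_abs (s : seq R) : R :=
  \prod_(j < size s) \prod_(k < size s | (j < k)%N) `|s`_j - s`_k|.
Definition wJ (a b : R) (x : R) : R := powR (1 - x) (a / 2) * powR (1 + x) (b / 2).
Definition GN1 (a b : R) (N : nat) (f : R -> R) : R :=
  nint N (fun s => vdm_abs s * \prod_(j < N) (wJ a b s`_j * (1 + f s`_j)))
  / nint N (fun s => vdm_abs s * \prod_(j < N) wJ a b s`_j).

Definition TJOE (a b : R) (N : nat) (f df : R -> R) : kernel :=
  let S := SN1 a b N in
  let g2 := fun x => f x ^+ 2 + 2 * f x in
  let u := epsf (phi1 a b N) in
  let v := phi1 a b N.-1 in
  let C := CN1 a b N in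
  fun x y =>
    kmulr S g2 x y
  - kmulr (kcomp S epsk) df x y
  - kmulr (kcomp (kmulr S f) epsk) df x y
  + C * kmulr (tensor u v) g2 x y
  + C * kmulr (tensor u (epsf v)) df x y
  - C * kmulr (kcomp (kmulr (tensor u v) f) epsk) df x y.

End Defs.

(* Main.v *)
(* With p_j the orthonormal Jacobi polynomials of parameters (a + 1, b + 1),
   phi_j = w p_j. Put F_j = (1 - x^2) phi_j and, for a function f,
   M(f)_ij = <phi_i (1 + f), eps (phi_j (1 + f))>, a skew-symmetric matrix.

   De Bruijn's formula gives [G_N(f)]^2 = det M(f) / det M(0). On the other side
   the kernel of T_JOE is sum_{j < N} Ft_j(x) Q_j(y), where Ft_j = F_j for
   j < N - 1 and Ft_{N-1} = F_{N-1} + C_N eps phi_N, so its Fredholm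
   determinant is det (1 + <Q_i, Ft_j>).

   Since F_j vanishes at the end points, F_j = eps F_j', and F_j' is w times a
   polynomial of degree j + 1; the constant C_N is exactly what cancels the phi_N
   component of F_{N-1}'. Hence Ft_j = sum_{k < N} mu_kj eps phi_k. Since N is even,
   the skew form <., eps .> is degenerate on span(phi_0, ..., phi_N), with radical
   spanned by phi_N, so <phi_i, Ft_j> = delta_ij and mu = M(0)^-1. Finally
   eps (f' e) = f e - eps (f e') for f(+-1) = 0 yields
   <Q_i, eps phi_k> = M(f)_ik - M(0)_ik, so the Fredholm determinant
   is det (M(f) mu). *)
Require Import Defs.
From HB Require Import structures.
From mathcomp Require Import all_boot all_order all_fingroup all_algebra.
From mathcomp Require Import all_classical all_reals all_analysis.
From mathcomp Require Import measurable_realfun.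
From mathcomp Require Import ring lra zify.
Import Order.TTheory GRing.Theory Num.Theory.
Import numFieldNormedType.Exports.
Local Open Scope classical_set_scope.
Local Open Scope ring_scope.
Set Implicit Arguments. Unset Strict Implicit. Unset Printing Implicit Defensive.

(** * Integration on [-1, 1] and the operator eps *)

Section Integral.
Variable R : realType.
Local Notation mu := (@lebesgue_measure R).
Local Notation I11 := [set` `[(-1)%R : R, 1%R]].
Implicit Types (f g h F : R -> R) (x : R).

(** For negative [a] or [b] the weight w is unbounded at an end point, and phi_j may fail to be
    square integrable. So the calculus below uses functions that are integrable on [-1, 1] and
    continuous only inside, and each product that is integrated has at most one factor of this kind;
    the other is continuous up to the ends, as eps g always is. The parameters (a + 1, b + 1) arise
    because w^2 (1 - x^2) is the Jacobi weight with these exponents, which makes the F_j dual to the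
    phi_i in L^2. Pfaffians enter only as an unnormalized sum over permutations, and only as a
    quotient: constants that depend on N alone cancel in G_N, and the sign disappears in the square.
    The denominator of G_N is nonzero because M(0) has the right inverse mu. The constant C_N is a
    ratio of leading coefficients of orthonormal polynomials; it is computed from recurrences for
    leading coefficients and norms, which come from integration by parts and finite differences
    instead of Gamma functions. *)

Definition intg g := mu.-integrable I11 (EFin \o g).

Lemma intg_eq g h : {in I11, g =1 h} -> intg g -> intg h.
Proof.
move=> gh; apply: eq_integrable => //= x xI; congr EFin; exact: gh.
Qed.

Lemma int11_eq g h : {in I11, g =1 h} -> int11 g = int11 h.
Proof. by move=> gh; rewrite /int11; apply: eq_Rintegral. Qed.

Lemma intgD g h : intg g -> intg h -> intg (fun x => g x + h x).
Proof. by move=> ig ih; exact: (integrableD _ ig ih). Qed.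

Lemma intgZ c g : intg g -> intg (fun x => c * g x).
Proof. by move=> ig; exact: (integrableZl _ _ ig). Qed.

Lemma intgZr c g : intg g -> intg (fun x => g x * c).
Proof. by move=> /(intgZ c); apply: intg_eq => x _; rewrite mulrC. Qed.

Lemma intgN g : intg g -> intg (fun x => - g x).
Proof. by move=> /(intgZ (-1)); apply: intg_eq => x _; rewrite mulN1r. Qed.

Lemma intg0 : intg (fun=> 0).
Proof. exact: integrable0. Qed.

Lemma intg_sum (I : Type) (s : seq I) (P : pred I) (G : I -> R -> R) :
  (forall i, P i -> intg (G i)) -> intg (fun x => \sum_(i <- s | P i) G i x).
Proof.
move=> iG; elim: s => [|i s ih].
  by apply: intg_eq intg0 => x _; rewrite big_nil.
case Pi : (P i); last by apply: intg_eq ih => x _; rewrite big_cons Pi.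
apply: intg_eq (intgD (iG _ Pi) ih) => x _.
by rewrite big_cons Pi.
Qed.

Lemma int11D g h : intg g -> intg h -> int11 (fun x => g x + h x) = int11 g + int11 h.
Proof. by move=> ig ih; rewrite /int11 RintegralD. Qed.

Lemma int11Z c g : intg g -> int11 (fun x => c * g x) = c * int11 g.
Proof. by move=> ig; rewrite /int11 RintegralZl. Qed.

Lemma int11Zr c g : intg g -> int11 (fun x => g x * c) = int11 g * c.
Proof. by move=> ig; rewrite /int11 RintegralZr. Qed.

Lemma int11N g : intg g -> int11 (fun x => - g x) = - int11 g.
Proof.
by move=> ig; rewrite -mulN1r -int11Z//; apply: int11_eq => x _; rewrite mulN1r.
Qed.

Lemma int11B g h : intg g -> intg h -> int11 (fun x => g x - h x) = int11 g - int11 h.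
Proof. by move=> ig ih; rewrite /int11 RintegralB. Qed.

Lemma int11_0 : int11 (fun=> 0 : R) = 0.
Proof. by rewrite /int11 /Rintegral integral0. Qed.

Lemma int11_sum (I : Type) (s : seq I) (P : pred I) (G : I -> R -> R) :
  (forall i, P i -> intg (G i)) ->
  int11 (fun x => \sum_(i <- s | P i) G i x) = \sum_(i <- s | P i) int11 (G i).
Proof.
move=> iG; elim: s => [|i s ih].
  rewrite big_nil -[RHS]int11_0; apply: int11_eq => x _; exact: big_nil.
rewrite big_cons -ih; case: ifPn => [Pi|nPi]; last first.
  by apply: int11_eq => x _; rewrite big_cons (negbTE nPi).
rewrite -int11D//; [|exact: iG|exact: intg_sum].
by apply: int11_eq => x _; rewrite big_cons Pi.
Qed.

Lemma in_I11 x : (x \in I11) = (-1 <= x <= 1).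
Proof. by rewrite mem_setE in_itv. Qed.

Lemma measurable_intg g : intg g -> measurable_fun I11 g.
Proof. by move/integrableP => [/measurable_EFinP]. Qed.

Lemma intgM_bounded g h (M : R) : measurable_fun I11 h ->
  (forall x, x \in I11 -> `|h x| <= M) -> intg g -> intg (fun x => g x * h x).
Proof.
move=> mh bh ig; have mg := measurable_intg ig.
apply: (@le_integrable _ _ R mu I11 _ (EFin \o (fun x => g x * h x)) (EFin \o (fun x => M * g x))).
- exact: measurable_itv.
- by apply/measurable_EFinP; exact: measurable_funM.
- move=> x /mem_set xI /=; rewrite lee_fin !normrM mulrC ler_wpM2r//.
  by rewrite (le_trans (bh _ xI))// ler_norm.
- exact: intgZ.
Qed.

Lemma within_bounded F : {within I11, continuous F} ->
  exists M, forall x, x \in I11 -> `|F x| <= M.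
Proof.
move=> cF.
have /compact_bounded[M [_ hM]] : compact (F @` I11).
  by apply: continuous_compact => //; exact: segment_compact.
exists (M + 1) => x /set_mem xI.
apply: hM; first by rewrite ltrDl.
by exists x.
Qed.

Lemma measurable_within F : {within I11, continuous F} -> measurable_fun I11 F.
Proof. by move=> cF; apply: subspace_continuous_measurable_fun. Qed.

Lemma intgM_within g F : {within I11, continuous F} -> intg g -> intg (fun x => g x * F x).
Proof.
move=> cF ig; have [M hM] := within_bounded cF.
exact: (intgM_bounded (measurable_within cF) hM ig).
Qed.

Lemma intg_within F : {within I11, continuous F} -> intg F.
Proof.
by move=> cF; apply: continuous_compact_integrable => //; exact: segment_compact.
Qed.

(** Identities between weights can fail at -1 and 1, where [powR] takes its conventional values at
    0; the two end points form a null set. *)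
Lemma intg_eqoo g h : (forall x, -1 < x < 1 -> g x = h x) -> intg g -> intg h.
Proof.
move=> gh ig.
have mg : measurable_fun [set` `](-1)%R : R, 1%R[] g.
  apply: measurable_funS (measurable_intg ig) => //; exact: subset_itv_oo_cc.
have mh : measurable_fun I11 h.
  apply: (@measurable_fun_itv_cc R _ _ false true).
  by apply: eq_measurable_fun mg => x; rewrite inE/= in_itv/= => /gh.
have m2 : measurable ([set (-1)%R; 1%R] : set R) by exact: measurableU.
have m0 : mu [set (-1)%R; 1%R] = 0%E.
  apply/eqP; rewrite -measure_le0 (le_trans (measureU2 _ _ _))//.
  by rewrite /= !lebesgue_measure_set1 adde0.
apply/(@negligible_integrable _ _ R mu I11 _ (EFin \o h) m2 _ _ m0) => //; first exact/measurable_EFinP.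
have : mu.-integrable (I11 `\` [set (-1)%R; 1%R]) (EFin \o g).
  by apply/(@negligible_integrable _ _ R mu I11 _ (EFin \o g) m2 _ _ m0) => //; apply/measurable_EFinP; exact: measurable_intg.
apply: eq_integrable; first exact: measurableD.
move=> x; rewrite inE/= in_itv/= => -[/andP[x1 x2] /not_orP[/eqP n1 /eqP n2]].
by rewrite gh// !lt_neqAle x1 x2 n2 eq_sym n1.
Qed.

Lemma int11_eqoo g h : (forall x, -1 < x < 1 -> g x = h x) -> intg g ->
  int11 g = int11 h.
Proof.
move=> gh ig; have ih := intg_eqoo gh ig.
rewrite /int11 /Rintegral; congr fine; apply: eq_integral_itv_bounded.
- apply: measurable_funS (measurable_intg ig) => //; exact: subset_itv_oo_cc.
- apply: measurable_funS (measurable_intg ih) => //; exact: subset_itv_oo_cc.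
- by move=> x; rewrite in_itv/=; exact: gh.
Qed.

Definition prim g x := \int[mu]_(t in `[(-1)%R, x]) g t.

Lemma prim_within g : intg g -> {within I11, continuous (prim g)}.
Proof. by move=> ig; apply: parameterized_integral_continuous; rewrite ?lerN10// (le_trans (lerN10 _)). Qed.

Lemma primN1 g : prim g (-1) = 0.
Proof. by rewrite /prim set_itv1 Rintegral_set1. Qed.

Lemma prim1 g : prim g 1 = int11 g.
Proof. by []. Qed.

Lemma is_derive_prim g x : intg g -> -1 < x < 1 -> {for x, continuous g} ->
  is_derive x 1 (prim g) (g x).
Proof.
move=> ig /andP[x1 x2] cg.
have [d e] := continuous_FTC1_closed x2 ig x1 cg.
by split => //; rewrite -derive1E.
Qed.

(* Also covers integrands that are unbounded at the end points. *)
Lemma prim_FTC F g : intg g -> {within I11, continuous F} ->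
  (forall x, -1 < x < 1 -> is_derive x 1 F (g x)) ->
  (forall x, -1 < x < 1 -> {for x, continuous g}) ->
  forall x, x \in I11 -> prim g x = F x - F (-1).
Proof.
move=> ig cF dF cg x; rewrite in_I11 => /andP[x1 x2].
move: x1; rewrite le_eqVlt => /predU1P[<-|x1]; first by rewrite primN1 subrr.
have [||c _] := @MVT R (fun x => prim g x - F x) (fun=> 0) _ _ x1.
- move=> y; rewrite in_itv/= => /andP[y1 y2].
  have yI : -1 < y < 1 by rewrite y1 (lt_le_trans y2).
  rewrite -[0](subrr (g y)).
  by apply: is_deriveB; [exact: (is_derive_prim ig yI (cg _ yI))|exact: dF].
- have sub : `[(-1)%R, x] `<=` I11 by apply: subset_itvl; rewrite bnd_simp.
  apply: (continuous_subspaceW sub) => z; apply: continuousB.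
    exact: (prim_within ig).
  exact: cF.
rewrite mul0r primN1; lra.
Qed.

Lemma int11_FTC F g : intg g -> {within I11, continuous F} ->
  (forall x, -1 < x < 1 -> is_derive x 1 F (g x)) ->
  (forall x, -1 < x < 1 -> {for x, continuous g}) ->
  int11 g = F 1 - F (-1).
Proof.
move=> ig cF dF cg; rewrite -prim1; apply: prim_FTC => //.
by rewrite in_I11; lra.
Qed.

Lemma measurable_epsk x : measurable_fun I11 (epsk x).
Proof.
apply: measurable_funM => //.
rewrite (_ : (fun y => _) = fun y => if y < x then 1 else if x < y then -1 else 0).
  apply: (@measurable_funS _ _ _ _ setT) => //.
  apply: measurable_fun_ifT => //; first exact: measurable_fun_ltr.
  by apply: measurable_fun_ifT => //; exact: measurable_fun_ltr.
apply/funext => y; case: ltgtP => [yx|xy|->]; last by rewrite subrr sgr0.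
  by rewrite gtr0_sg ?subr_gt0.
by rewrite ltr0_sg ?subr_lt0.
Qed.

Lemma epskN x y : epsk x y = - epsk y x :> R.
Proof. by rewrite /epsk -opprB sgrN mulNr. Qed.

Lemma epsk_le x y : `|epsk x y| <= 1 :> R.
Proof. rewrite /epsk normrM normr_sg; case: (_ != _) => /=; rewrite ger0_norm//; lra. Qed.

Lemma intg_epsk g x : intg g -> intg (fun y => epsk x y * g y).
Proof.
move=> ig; apply: (intg_eq (g := fun y => g y * epsk x y)) => [y _|].
  by rewrite mulrC.
apply: (intgM_bounded (M := 1)) => //; first exact: measurable_epsk.
by move=> y _; exact: epsk_le.
Qed.

(** Splitting the integral at x, the kernel is 1/2 on the left and -1/2 on the right. Thus eps g is
    the antiderivative of g with opposite values at the two ends, and all later facts about eps come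
    from this form. *)
Lemma epsf_prim g x : intg g -> x \in I11 -> epsf g x = prim g x - int11 g / 2.
Proof.
move=> ig; rewrite in_I11 => /andP[x1 x2].
have sp h : intg h -> int11 h = prim h x + \int[mu]_(t in `]x, 1%R]) h t.
  move=> ih; rewrite -(Rintegral_itvB (f := h) (a := BLeft (-1)) (x := x))//.
  by rewrite addrC subrK.
rewrite {1}/epsf sp; last exact: intg_epsk.
rewrite [in RHS]sp//.
have -> : prim (fun y => epsk x y * g y) x = prim g x / 2.
  have ->: prim g x / 2 = \int[mu]_(t in `[(-1)%R, x[) (1/2 * g t).
    have igs : mu.-integrable `[(-1)%R, x[ (EFin \o g).
      apply: integrableS ig => //; apply: subset_itvl; rewrite bnd_simp//; exact: ltW.
    by rewrite RintegralZl// Rintegral_itv_bndo_bndc// mulrC mul1r.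
  rewrite /prim -Rintegral_itv_bndo_bndc; last first.
    apply: integrableS (intg_epsk x ig) => //; apply: subset_itvl; rewrite bnd_simp//; exact: ltW.
  apply: eq_Rintegral => y; rewrite inE/= in_itv/= => /andP[_ yx].
  by rewrite /epsk gtr0_sg ?subr_gt0.
have -> : \int[mu]_(t in `]x, 1%R]) (epsk x t * g t) = - (\int[mu]_(t in `]x, 1%R]) g t / 2).
  have igs : mu.-integrable `]x, 1%R] (EFin \o g).
    by apply: integrableS ig => //; apply: subset_itvr; rewrite bnd_simp.
  rewrite -mulrN mulrC -RintegralZl//.
  apply: eq_Rintegral => y; rewrite inE/= in_itv/= => /andP[yx _].
  rewrite /epsk ltr0_sg ?subr_lt0//; lra.
lra.
Qed.

(** The class that contains the phi_j: no continuity is asked at the end points, where the exponents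
    a/2 and b/2 > -1 may be negative. *)
Definition cintg g := intg g /\ forall x, -1 < x < 1 -> {for x, continuous g}.

Lemma epsf_within g : intg g -> {within I11, continuous (epsf g)}.
Proof.
move=> ig; have : {within I11, continuous (fun x => prim g x - int11 g / 2)}.
  move=> x; apply: continuousB; [exact: (prim_within ig)|exact: cst_continuous].
by apply: subspace_eq_continuous => x xI; rewrite [RHS]epsf_prim.
Qed.

Lemma near_oo (x : R) : -1 < x < 1 -> \forall y \near x, -1 < y < 1.
Proof.
move=> /andP[x1 x2]; near=> y; apply/andP; split; near: y.
  exact: lt_nbhsr. exact: lt_nbhsl.
Unshelve. all: by end_near. Qed.

Lemma is_derive_epsf g x : cintg g -> -1 < x < 1 -> is_derive x 1 (epsf g) (g x).
Proof.
move=> [ig cg] xI.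
have d : is_derive x 1 (fun x => prim g x - int11 g / 2) (g x).
  rewrite -[g x]subr0; apply: is_deriveB; first exact: (is_derive_prim ig xI (cg _ xI)).
apply: (near_eq_is_derive _ d) => //.
near=> y; rewrite epsf_prim// in_I11.
have /andP[] : -1 < y < 1 by near: y; exact: near_oo.
by move=> /ltW -> /ltW ->.
Unshelve. all: by end_near. Qed.

Lemma epsf1 g : intg g -> epsf g 1 = int11 g / 2.
Proof. move=> ig; rewrite epsf_prim ?prim1 ?in_I11//; lra. Qed.

Lemma epsfN1 g : intg g -> epsf g (-1) = - (int11 g / 2).
Proof. move=> ig; rewrite epsf_prim ?primN1 ?in_I11//; lra. Qed.

(** Among the antiderivatives of g, eps g is the one with opposite end values; a function vanishing
    at both ends has this property, so on such functions eps inverts differentiation. *)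
Lemma epsf_FTC F g : cintg g -> {within I11, continuous F} ->
  (forall x, -1 < x < 1 -> is_derive x 1 F (g x)) -> F 1 = 0 -> F (-1) = 0 ->
  forall x, x \in I11 -> epsf g x = F x.
Proof.
move=> [ig cg] cF dF F1 FN1 x xI; rewrite epsf_prim// (prim_FTC ig cF dF cg)//.
rewrite (int11_FTC ig cF dF cg); lra.
Qed.

Lemma within_mul F h : {within I11, continuous F} -> {within I11, continuous h} ->
  {within I11, continuous (fun x => F x * h x)}.
Proof. by move=> cF ch x; apply: continuousM; [exact: cF|exact: ch]. Qed.

Lemma within_oo F x : {within I11, continuous F} -> -1 < x < 1 -> {for x, continuous F}.
Proof.
move=> cF /andP[x1 x2].
apply: (within_continuous_continuous _ cF); first by lra.
by rewrite in_itv/= x1 x2.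
Qed.

Lemma cintgM g F : {within I11, continuous F} -> cintg g -> cintg (fun x => g x * F x).
Proof.
move=> cF [ig cg]; split; first exact: intgM_within.
by move=> x xI; apply: continuousM; [exact: cg|exact: within_oo].
Qed.

Lemma cintgD g h : cintg g -> cintg h -> cintg (fun x => g x + h x).
Proof.
move=> [ig cg] [ih ch]; split; first exact: intgD.
by move=> x xI; apply: continuousD; [exact: cg|exact: ch].
Qed.

(** Integration by parts: the sum of the two integrands is the derivative of eps g times eps h. Both
    factors change sign from one end to the other, so the product has equal end values. *)
Lemma int11_epsf_skew g h : cintg g -> cintg h ->
  int11 (fun x => g x * epsf h x) = - int11 (fun x => h x * epsf g x).
Proof.
move=> cg ch; have [ig _] := cg; have [ih _] := ch.
have c1 := cintgM (epsf_within ih) cg.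
have c2 := cintgM (epsf_within ig) ch.
have c12 := cintgD c1 c2.
apply/eqP; rewrite -addr_eq0 -int11D; [|exact: c1.1|exact: c2.1].
have cF : {within I11, continuous (fun x => epsf g x * epsf h x)}.
  by apply: within_mul; exact: epsf_within.
have dF x : -1 < x < 1 ->
    is_derive x 1 (fun x => epsf g x * epsf h x) (g x * epsf h x + h x * epsf g x).
  move=> xI; apply: is_derive_eq.
    by apply: is_deriveM; [exact: is_derive_epsf|exact: is_derive_epsf].
  by rewrite /GRing.scale/=; ring.
rewrite (int11_FTC c12.1 cF dF c12.2).
by rewrite !epsf1// !epsfN1//; apply/eqP; ring.
Qed.

End Integral.

(** * Continuity, derivatives and integrability of the weights (1 - x)^al (1 + x)^be *)

Section Weights.
Variable R : realType.
Local Notation mu := (@lebesgue_measure R).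
Local Notation I11 := [set` `[(-1)%R : R, 1%R]].
Implicit Types (f g h F : R -> R) (x al be : R).

Lemma within_ext F h : (forall x, -1 <= x <= 1 -> F x = h x) ->
  {within I11, continuous F} -> {within I11, continuous h}.
Proof.
move=> Fh; apply: subspace_eq_continuous => x; rewrite in_I11; exact: Fh.
Qed.

Lemma within_continuous F : continuous F -> {within I11, continuous F}.
Proof. by move=> cF; exact: continuous_subspaceT. Qed.

(* Nonnegativity makes the integrals over an exhausting sequence of segments
   monotone, so the bounded antiderivative alone forces integrability. *)
Lemma intg_ge0_FTC F g : measurable_fun I11 g -> {within I11, continuous F} ->
  (forall x, -1 < x < 1 -> is_derive x 1 F (g x)) ->
  (forall x, -1 < x < 1 -> {for x, continuous g}) ->
  (forall x, -1 < x < 1 -> 0 <= g x) -> intg g.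
Proof.
move=> mg cF dF cg g0.
have [e [e0 e2 edec ecvg]] : exists e : nat -> R, [/\ forall n, 0 < e n,
    forall n, e n <= 2^-1, forall m n, (m <= n)%N -> e n <= e m
    & forall y : R, 0 < y -> exists n, e n < y].
  (* The shift by 2 bounds [e n] by 1/2, so that every segment has positive length. *)
  exists (fun n => n.+2%:R^-1); split => [n|n|m n mn|y y0].
  - by rewrite invr_gt0 ltr0n.
  - by rewrite lef_pV2 ?posrE ?ltr0n// ler_nat.
  - by rewrite lef_pV2 ?posrE ?ltr0n// ler_nat !ltnS.
  - exists (Num.bound y^-1); rewrite invf_plt ?posrE ?ltr0n//.
    apply: lt_le_trans (archi_boundP _) _; first by rewrite invr_ge0 ltW.
    by rewrite ler_nat -addn2 leq_addr.
pose A (n : nat) : set R := [set` `[(-1 + e n)%R : R, 1 - e n]].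
have AP n x : A n x <-> -1 + e n <= x <= 1 - e n by rewrite /A /= in_itv.
have Aoo n x : A n x -> -1 < x < 1.
  by move=> /AP /andP[x1 x2]; have := e0 n; lra.
have sub n : A n `<=` I11.
  move=> x /Aoo /andP[x1 x2]; rewrite /= in_itv/=; lra.
have [M hM] := within_bounded cF.
have cF' x : -1 < x < 1 -> {for x, continuous F}.
  by move=> xI; exact: within_oo.
have bnd n : (\int[mu]_(x in A n) (g x)%:E <= (M + M)%:E)%E.
  have lt12 : (-1 + e n)%R < (1 - e n)%R :> R by have := e2 n; lra.
  rewrite (@continuous_FTC2 _ g F _ _ lt12).
  - rewrite -EFinB lee_fin.
    have h3 : `|F (-1 + e n)| <= M.
      by apply: hM; rewrite in_I11; have := e0 n; have := e2 n; lra.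
    have h4 : `|F (1 - e n)| <= M.
      by apply: hM; rewrite in_I11; have := e0 n; have := e2 n; lra.
    by rewrite (le_trans (ler_norm _))// (le_trans (ler_normB _ _))// lerD.
  - apply: continuous_in_subspaceT => x; rewrite inE => /Aoo; exact: cg.
  - split.
    + move=> x; rewrite in_itv/= => /andP[x1 x2].
      have xI : -1 < x < 1 by have := e0 n; lra.
      exact: (@ex_derive _ _ _ _ _ _ _ (dF _ xI)).
    + by apply/cvg_at_right_filter/cF'; have := e0 n; have := e2 n; lra.
    + by apply/cvg_at_left_filter/cF'; have := e0 n; have := e2 n; lra.
  - move=> x; rewrite in_itv/= => /andP[x1 x2].
    have xI : -1 < x < 1 by have := e0 n; lra.
    by rewrite derive1E; have [_ ->] := dF _ xI.
have UA : \bigcup_n A n = [set` `](-1)%R : R, 1%R[].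
  apply/seteqP; split => [x [n _ /Aoo]|x /=]; first by rewrite /= in_itv.
  rewrite in_itv/= => /andP[x1 x2].
  have [n hn] := ecvg (Num.min (x + 1) (1 - x)) ltac:(by rewrite lt_min; lra).
  by exists n => //; apply/AP; move: hn; rewrite lt_min; lra.
have Ahomo : {homo A : n m / (n <= m)%N >-> (n <= m)%O}.
  move=> m n mn; apply/subsetPset => x /AP; move=> h; apply/AP.
  by have := edec _ _ mn; lra.
have cvgA : (\int[mu]_(x in A i) (g x)%:E)%E @[i --> \oo] --> (\int[mu]_(x in \bigcup_i A i) (g x)%:E)%E.
  apply: (@ge0_nondecreasing_set_cvg_integral _ (measurableTypeR R) R A (EFin \o g) lebesgue_measure Ahomo).
  - by move=> i; exact: measurable_itv.
  - by move=> i; apply/measurable_EFinP; apply: measurable_funS mg.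
  - by move=> i x /Aoo xI /=; rewrite lee_fin g0.
rewrite UA in cvgA.
have moo : measurable_fun [set` `](-1)%R : R, 1%R[] g.
  by apply: measurable_funS mg => //; exact: subset_itv_oo_cc.
have ioo : (\int[mu]_(x in [set` `](-1)%R : R, 1%R[]) (g x)%:E <= (M + M)%:E)%E.
  have cv : cvgn (fun i => \int[mu]_(x in A i) (g x)%:E)%E by apply/cvg_ex; eexists; exact: cvgA.
  rewrite -(cvg_lim _ cvgA)//; apply: lime_le => //.
  by apply: nearW.
have : mu.-integrable [set` `](-1)%R : R, 1%R[] (EFin \o g).
  apply/integrableP; split; first exact/measurable_EFinP.
  apply: le_lt_trans (ltry (M + M)); apply: le_trans ioo.
  rewrite le_eqVlt; apply/orP; left; apply/eqP; apply: eq_integral => x.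
  by rewrite inE/= in_itv/= => xI; rewrite ger0_norm// g0.
rewrite integrable_mkcond// => io.
suff : intg (g \_ [set` `](-1)%R : R, 1%R[]).
  by apply: intg_eqoo => x xI; rewrite patchE mem_set//= in_itv.
rewrite /intg -restrict_EFin.
exact: integrableS io.
Qed.

Lemma is_derive_mul F h x (df dh : R) : is_derive x 1 F df -> is_derive x 1 h dh ->
  is_derive x 1 (fun t : R => F t * h t) (df * h x + F x * dh).
Proof.
move=> dF' dh'; apply: (is_derive_eq (is_deriveM dF' dh')).
by rewrite /GRing.scale/=; ring.
Qed.

Lemma is_derive_scale F c x (df : R) : is_derive x 1 F df ->
  is_derive x 1 (fun t : R => c * F t) (c * df).
Proof.
by move=> dF'; apply: (is_derive_eq (is_deriveZ c dF')).
Qed.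

Lemma derive_powB al x : x < 1 ->
  is_derive x 1 (fun t => (1 - t) `^ al) (- (al * (1 - x) `^ (al - 1))).
Proof.
move=> x1.
have d : is_derive x 1 (fun t : R => 1 - t) (-1).
  by rewrite -[-1]add0r; apply: is_deriveB.
have p : is_derive (1 - x) 1 (fun y => y `^ al) (al * (1 - x) `^ (al - 1)).
  by apply: is_derive1_powR; rewrite subr_gt0.
have := @is_derive1_comp _ (fun y => y `^ al) (fun t : R => 1 - t) x _ _ p d.
by move=> h; apply: is_derive_eq h _; rewrite /GRing.scale/=; ring.
Qed.

Lemma derive_powD be x : -1 < x ->
  is_derive x 1 (fun t => (1 + t) `^ be) (be * (1 + x) `^ (be - 1)).
Proof.
move=> x1.
have d : is_derive x 1 (fun t : R => 1 + t) 1.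
  by rewrite -[1 in X in is_derive _ _ _ X]add0r; apply: is_deriveD.
have p : is_derive (1 + x) 1 (fun y => y `^ be) (be * (1 + x) `^ (be - 1)).
  by apply: is_derive1_powR; lra.
have := @is_derive1_comp _ (fun y => y `^ be) (fun t : R => 1 + t) x _ _ p d.
by move=> h; apply: is_derive_eq h _; rewrite /GRing.scale/=; ring.
Qed.

Lemma is_derive_continuous f x df : is_derive x 1 f df -> {for x, continuous f}.
Proof. by move=> d; apply/differentiable_continuous/derivable1_diffP; exact: (@ex_derive _ _ _ _ _ _ _ d). Qed.

Lemma powB_oo al x : x < 1 -> {for x, continuous (fun t : R => (1 - t) `^ al)}.
Proof. by move=> x1; exact: is_derive_continuous (derive_powB al x1). Qed.

Lemma powD_oo be x : -1 < x -> {for x, continuous (fun t : R => (1 + t) `^ be)}.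
Proof. by move=> x1; exact: is_derive_continuous (derive_powD be x1). Qed.

(** The absolute value keeps the base nonnegative, so continuity can be stated on the whole line; on
    [-1, 1] the bases 1 - t and 1 + t equal their absolute values. *)
Lemma norm_powR_continuous al : 0 < al -> continuous (fun t : R => `|t| `^ al).
Proof.
move=> al0 x; have [->|x0] := eqVneq x 0.
  apply/cvgrPdist_lt => e e0; rewrite normr0 powR0 ?gt_eqF//.
  near=> t; rewrite sub0r normrN ger0_norm ?powR_ge0//.
  have : `|t| < e `^ al^-1.
    near: t; exists (e `^ al^-1); first by rewrite /= powR_gt0.
    by move=> y; rewrite /= sub0r normrN.
  move=> /(gt0_ltr_powR al0); rewrite -powRrM mulVf ?gt_eqF// powRr1 ?ltW//.
  by apply; rewrite nnegrE ?powR_ge0.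
apply: (@continuous_comp R R R (fun t : R => `|t|) (fun y : R => y `^ al)); first exact: norm_continuous.
by apply: is_derive_continuous; apply: is_derive1_powR; rewrite normr_gt0.
Unshelve. all: by end_near. Qed.

Lemma powB_within al : 0 < al -> {within I11, continuous (fun t : R => (1 - t) `^ al)}.
Proof.
move=> al0; have : {within I11, continuous (fun t : R => `|1 - t| `^ al)}.
  apply: continuous_subspaceT => x.
  apply: (@continuous_comp _ _ _ (fun t : R => 1 - t) (fun t : R => `|t| `^ al)).
    by apply: continuousB; [exact: cst_continuous|exact: id].
  exact: norm_powR_continuous.
apply: within_ext => x /andP[_ x1].
by rewrite ger0_norm// subr_ge0.
Qed.

Lemma powD_within al : 0 < al -> {within I11, continuous (fun t : R => (1 + t) `^ al)}.
Proof.
move=> al0; have : {within I11, continuous (fun t : R => `|1 + t| `^ al)}.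
  apply: continuous_subspaceT => x.
  apply: (@continuous_comp _ _ _ (fun t : R => 1 + t) (fun t : R => `|t| `^ al)).
    by apply: continuousD; [exact: cst_continuous|exact: id].
  exact: norm_powR_continuous.
apply: within_ext => x /andP[x1 _].
by rewrite ger0_norm//; lra.
Qed.

Lemma jweight_within al be : 0 < al -> 0 < be -> {within I11, continuous (jweight al be)}.
Proof. by move=> al0 be0; apply: within_mul; [exact: powB_within|exact: powD_within]. Qed.

Lemma measurable_powB al : measurable_fun I11 (fun t : R => (1 - t) `^ al).
Proof.
apply: (@measurable_funS _ _ _ _ setT) => //.
apply: (measurableT_comp (measurable_powR al)).
exact: measurable_funB.
Qed.

Lemma measurable_powD al : measurable_fun I11 (fun t : R => (1 + t) `^ al).
Proof.
apply: (@measurable_funS _ _ _ _ setT) => //.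
apply: (measurableT_comp (measurable_powR al)).
exact: measurable_funD.
Qed.

Lemma intg_powB al : -1 < al -> intg (fun t : R => (1 - t) `^ al).
Proof.
move=> al1; have a0 : 0 < al + 1 by lra.
apply: (@intg_ge0_FTC (fun t => - (al + 1)^-1 * (1 - t) `^ (al + 1))).
- exact: measurable_powB.
- apply: within_mul; last exact: (powB_within a0).
  by apply: within_continuous => x; exact: cst_continuous.
- move=> x /andP[_ x1].
  have d := derive_powB (al + 1) x1.
  apply: (is_derive_eq (is_derive_scale _ d)).
  rewrite addrK mulrNN mulKf// gt_eqF//.
- by move=> x /andP[_ x1]; exact: powB_oo.
- by move=> x _; exact: powR_ge0.
Qed.

Lemma intg_powD al : -1 < al -> intg (fun t : R => (1 + t) `^ al).
Proof.
move=> al1; have a0 : 0 < al + 1 by lra.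
apply: (@intg_ge0_FTC (fun t => (al + 1)^-1 * (1 + t) `^ (al + 1))).
- exact: measurable_powD.
- apply: within_mul; last exact: (powD_within a0).
  by apply: within_continuous => x; exact: cst_continuous.
- move=> x /andP[x1 _].
  have d := derive_powD (al + 1) x1.
  apply: (is_derive_eq (is_derive_scale _ d)).
  rewrite addrK mulKf// gt_eqF//.
- by move=> x /andP[x1 _]; exact: powD_oo.
- by move=> x _; exact: powR_ge0.
Qed.

Lemma powR_le12 be y : 1 <= y <= 2 -> y `^ be <= 2 `^ `|be|.
Proof.
move=> /andP[y1 y2]; apply: (@le_trans _ _ (y `^ `|be|)).
  by apply: ler_powR => //; exact: ler_norm.
by apply: ge0_ler_powR; rewrite ?nnegrE//; lra.
Qed.

Lemma cintg_jweight al be : -1 < al -> -1 < be -> cintg (jweight al be).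
Proof.
move=> al1 be1; split; last first.
  by move=> x /andP[x1 x2]; apply: continuousM; [exact: powB_oo|exact: powD_oo].
have iB := intg_powB al1; have iD := intg_powD be1.
(* On each half of the interval one of the bases lies in [1, 2], so its power is bounded and a
   single end point singularity remains; the dominating function adds the bounds for the two
   halves. *)
apply: (@le_integrable _ _ R mu I11 _ (EFin \o jweight al be)
  (EFin \o (fun x => 2 `^ `|be| * (1 - x) `^ al + 2 `^ `|al| * (1 + x) `^ be))).
- exact: measurable_itv.
- apply/measurable_EFinP; apply: measurable_funM; [exact: measurable_powB|exact: measurable_powD].
- move=> x /mem_set; rewrite in_I11 => /andP[x1 x2] /=; rewrite lee_fin.
  rewrite [X in X <= _]ger0_norm; last by rewrite mulr_ge0 ?powR_ge0.
  rewrite [X in _ <= X]ger0_norm; last by rewrite addr_ge0 ?mulr_ge0 ?powR_ge0.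
  rewrite /jweight.
  have [x0|x0] := leP 0 x.
    apply: ler_wpDr; first by rewrite mulr_ge0 ?powR_ge0.
    by rewrite mulrC ler_wpM2r ?powR_ge0//; apply: powR_le12; lra.
  apply: ler_wpDl; first by rewrite mulr_ge0 ?powR_ge0.
  by rewrite ler_wpM2r ?powR_ge0//; apply: powR_le12; lra.
- by apply: intgD; exact: intgZ.
Qed.

(** If the integral were zero, the primitive would vanish identically inside, and so would its
    derivative at 0; but the weight at 0 is 1. *)
Lemma int11_jweight_gt0 al be : -1 < al -> -1 < be -> 0 < int11 (jweight al be).
Proof.
move=> al1 be1; have [iw cw] := cintg_jweight al1 be1.
have w0 x : 0 <= jweight al be x by rewrite mulr_ge0 ?powR_ge0.
rewrite lt_neqAle Rintegral_ge0// andbT; apply/eqP => e0.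
have pr0 x : -1 < x < 1 -> prim (jweight al be) x = 0.
  move=> /andP[x1 x2]; apply/eqP; rewrite eq_le Rintegral_ge0// andbT.
  rewrite e0 -prim1 -subr_ge0 /prim Rintegral_itvB ?bnd_simp//=; last exact: ltW.
    exact: Rintegral_ge0.
  exact: ltW.
have h0 : -1 < (0 : R) < 1 by lra.
have d0 := is_derive_prim iw h0 (cw _ h0).
have d1 : is_derive (0 : R) (1 : R) (prim (jweight al be)) 0.
  apply: (near_eq_is_derive _ (is_derive_cst _ _ _)) => //.
  near=> y; rewrite pr0//; near: y; exact: near_oo.
have : jweight al be 0 = 0.
  by have [_ <-] := d0; have [_ ->] := d1.
by rewrite /jweight subr0 addr0 !powR1 mulr1 => /eqP; rewrite oner_eq0.
Unshelve. all: by end_near. Qed.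

End Weights.

(** * Rising factorials and their finite differences *)

Section Combinatorics.
Variable F : numFieldType.
Implicit Types (x y z : F) (m n s : nat).

(** The Pochhammer symbol; it stands for the quotient Gamma(z + n) / Gamma(z). *)
Definition rf z n := \prod_(i < n) (z + i%:R).

Lemma rf0 z : rf z 0 = 1.
Proof. by rewrite /rf big_ord0. Qed.

Lemma rfS z n : rf z n.+1 = rf z n * (z + n%:R).
Proof. by rewrite /rf big_ord_recr. Qed.

Lemma rfSl z n : rf z n.+1 = z * rf (z + 1) n.
Proof.
rewrite /rf big_ord_recl addr0; congr (_ * _); apply: eq_bigr => i _.
by rewrite -addrA nat1r.
Qed.

Lemma rfD z m n : rf z (m + n) = rf z m * rf (z + m%:R) n.
Proof.
elim: n => [|n ih]; first by rewrite addn0 rf0 mulr1.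
by rewrite addnS !rfS ih natrD addrA mulrA.
Qed.

Lemma rf_gt0 z n : 0 < z -> 0 < rf z n.
Proof. by move=> z0; apply: prodr_gt0 => i _; rewrite ltr_wpDr. Qed.

(** Backward differences act on rising factorials as derivatives act on powers. *)
Lemma rf_backdiff z m : rf z m.+1 - rf (z - 1) m.+1 = m.+1%:R * rf z m.
Proof. by rewrite rfS [rf (z - 1) _]rfSl subrK -(natr1 m); ring. Qed.

(** The n-th backward difference of the polynomial [rf _ m] of degree m. Its vanishing for m < n is
    the source of orthogonality, and its value for m = n gives the norms. *)
Definition fdiff n m z := \sum_(s < n.+1) (-1) ^+ s * 'C(n, s)%:R * rf (z - s%:R) m.

Lemma fdiffS0 n z : fdiff n.+1 0 z = 0.
Proof.
transitivity ((1 - 1 : F) ^+ n.+1); last by rewrite subrr expr0n.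
rewrite exprBn /fdiff.
apply: eq_bigr => i _; rewrite rf0 !expr1n !mulr1 mulr_natr; ring.
Qed.

(** Pascal's rule writes the difference of order n + 1 as one of order n applied to a first
    difference, which [rf_backdiff] evaluates. *)
Lemma fdiffSS n m z : fdiff n.+1 m.+1 z = m.+1%:R * fdiff n m z.
Proof.
rewrite /fdiff big_ord_recl /= mulr_sumr bin0 expr0 !mul1r subr0.
under eq_bigr => i _.
  rewrite /bump /= add1n binS natrD mulrDr mulrDl.
  over.
rewrite big_split /= addrA.
have -> : rf z m.+1 + \sum_(i < n.+1) (-1) ^+ i.+1 * 'C(n, i.+1)%:R * rf (z - i.+1%:R) m.+1
   = \sum_(i < n.+1) (-1) ^+ i * 'C(n, i)%:R * rf (z - i%:R) m.+1.
  rewrite [in LHS]big_ord_recr /= bin_small// mulr0 mul0r addr0.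
  by rewrite [in RHS]big_ord_recl /= bin0 expr0 !mul1r subr0.
rewrite -big_split /=; apply: eq_bigr => i _.
have := rf_backdiff (z - i%:R) m; rewrite -addrA -opprD natr1 => h.
rewrite mulrCA -h exprS; ring.
Qed.

Lemma fdiff_lt n m z : (m < n)%N -> fdiff n m z = 0.
Proof.
elim: n m z => // n ih [|m] z; first by rewrite fdiffS0.
by rewrite ltnS fdiffSS => /ih ->; rewrite mulr0.
Qed.

Lemma fdiff_diag n z : fdiff n n z = n`!%:R.
Proof.
elim: n => [|n ih]; last by rewrite fdiffSS ih factS natrM.
by rewrite /fdiff big_ord1 rf0 expr0 bin0 !mulr1.
Qed.

End Combinatorics.

(** * Binomial coefficients with a real upper argument *)

Section GBinom.
Variable R : realType.
Implicit Types (x y z : R).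

Lemma gbinom0 z : gbinom z 0 = 1.
Proof. by rewrite /gbinom big_ord0 divr1. Qed.

Lemma gbinomS z n : n.+1%:R * gbinom z n.+1 = (z - n%:R) * gbinom z n.
Proof.
rewrite /gbinom big_ord_recr /= factS natrM.
have := ltr0Sn R n; have : 0 < n`!%:R :> R by rewrite ltr0n fact_gt0.
move=> h1 h2; field; rewrite !gt_eqF//.
Qed.

Lemma gbinom_rf z n : n`!%:R * gbinom (n%:R + z) n = rf (z + 1) n.
Proof.
rewrite /gbinom mulrC divfK ?pnatr_eq0 -?lt0n ?fact_gt0// /rf.
rewrite (reindex_inj rev_ord_inj) /=; apply: eq_bigr => i _.
by rewrite natrB// -(natr1 i); ring.
Qed.

(** After multiplication by n + 1 = (n + 1 - s) + s, each half is absorbed into one binomial by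
    [gbinomS]. The two shifted sums recombine with factor (x - (n - s)) + (y - s) = x + y - n. *)
Lemma gbinom_Vandermonde x y n :
  \sum_(s < n.+1) gbinom x (n - s) * gbinom y s = gbinom (x + y) n.
Proof.
elim: n => [|n ih]; first by rewrite big_ord1 !gbinom0 mulr1.
apply: (@mulfI _ n.+1%:R); first by rewrite pnatr_eq0.
rewrite gbinomS -ih mulr_sumr.
have -> : \sum_(s < n.+2) n.+1%:R * (gbinom x (n.+1 - s) * gbinom y s) =
  \sum_(s < n.+2) ((n.+1 - s)%:R * gbinom x (n.+1 - s)) * gbinom y s +
  \sum_(s < n.+2) gbinom x (n.+1 - s) * (s%:R * gbinom y s).
  rewrite -big_split; apply: eq_bigr => s _ /=.
  have -> : n.+1%:R = (n.+1 - s)%:R + s%:R :> R by rewrite -natrD subnK// -ltnS.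
  ring.
rewrite big_ord_recr /= subnn !mul0r addr0.
rewrite [X in _ + X]big_ord_recl /= mul0r mulr0 add0r -big_split mulr_sumr.
apply: eq_bigr => s _ /=; rewrite /bump /= add1n subSS gbinomS.
have sn : (s <= n)%N by rewrite -ltnS.
rewrite subSn// gbinomS natrB//; ring.
Qed.

End GBinom.

(** * Expansion in a sequence of polynomials with one of each degree *)

Section PolyBasis.
Variable F : fieldType.

(** The top coefficient is recorded because the phi_N component of F_{N-1}' is read off from it. *)
Lemma poly_expand (P : nat -> {poly F}) (q : {poly F}) n :
  (forall i, size (P i) = i.+1) -> (size q <= n.+1)%N ->
  exists c : nat -> F, q = \sum_(i < n.+1) c i *: P i /\ c n * (P n)`_n = q`_n.
Proof.
move=> sP; elim: n q => [|n ih] q sq.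
  have P0 := size1_polyC (eq_leq (sP 0%N)).
  have c0 : (P 0%N)`_0 != 0.
    by apply/eqP => c0; have := sP 0%N; rewrite P0 c0 size_polyC eqxx.
  exists (fun=> q`_0 / (P 0%N)`_0); rewrite big_ord1 divfK//; split => //.
  by rewrite [LHS](size1_polyC sq) {2}P0 -mul_polyC -polyCM divfK.
have lc : (P n.+1)`_n.+1 != 0.
  by have := sP n.+1; rewrite -[X in _`_X]/(n.+2.-1) => <-; rewrite -lead_coefE lead_coef_eq0 -size_poly_eq0 sP.
pose c0 := q`_n.+1 / (P n.+1)`_n.+1.
have [|c [qE _]] := ih (q - c0 *: P n.+1).
  apply/leq_sizeP => j; rewrite leq_eqVlt => /predU1P[<-|nj].
    by rewrite coefB coefZ divfK// subrr.
  by rewrite coefB coefZ !nth_default ?sP// ?mulr0 ?subrr// (leq_trans sq).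
exists (fun i => if i == n.+1 then c0 else c i); rewrite eqxx divfK//; split => //.
rewrite big_ord_recr /= eqxx -[LHS](subrK (c0 *: P n.+1)) qE; congr (_ + _).
by apply: eq_bigr => i _; rewrite ltn_eqF.
Qed.

End PolyBasis.

(** * Jacobi polynomials *)

Section Jacobi.
Variable R : realType.
Local Notation I11 := [set` `[(-1)%R : R, 1%R]].
Implicit Types (x al be : R) (p q : {poly R}) (m n : nat).

Lemma jweightDn al be m n x : -1 < x < 1 ->
  jweight (al + m%:R) (be + n%:R) x = jweight al be x * ((1 - x) ^+ m * (1 + x) ^+ n).
Proof.
move=> /andP[x1 x2].
have h1 : 0 < 1 - x by lra. have h2 : 0 < 1 + x by lra.
rewrite /jweight !powRD ?(gt_eqF h1) ?(gt_eqF h2) ?implybT//.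
by rewrite !powR_mulrn ?ltW//; ring.
Qed.

Lemma derive_jweight al be x : -1 < x < 1 ->
  is_derive x 1 (jweight (al + 1) (be + 1))
    (- (al + 1) * jweight al (be + 1) x + (be + 1) * jweight (al + 1) be x).
Proof.
move=> /andP[x1 x2].
apply: (is_derive_eq (is_derive_mul (derive_powB (al + 1) x2) (derive_powD (be + 1) x1))).
by rewrite /jweight !addrK; ring.
Qed.

(** The weight with both exponents raised vanishes at both ends, so its derivative integrates to
    zero. Together with [int11_jweight_halves] this is a linear system for the integrals with one
    exponent raised, which replaces the evaluation of the Beta integral. *)
Lemma jweight_FTC al be : -1 < al -> -1 < be ->
  (al + 1) * int11 (jweight al (be + 1)) = (be + 1) * int11 (jweight (al + 1) be).
Proof.
move=> al1 be1.
have [i1 c1] := cintg_jweight al1 (ltr_wpDr ler01 be1 : -1 < be + 1).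
have [i2 c2] := cintg_jweight (ltr_wpDr ler01 al1 : -1 < al + 1) be1.
have i12 : intg (fun x => - (al + 1) * jweight al (be + 1) x + (be + 1) * jweight (al + 1) be x).
  by apply: intgD; exact: intgZ.
have a0 : 0 < al + 1 by lra. have b0 : 0 < be + 1 by lra.
have := int11_FTC i12 (jweight_within a0 b0) (@derive_jweight al be) _.
rewrite int11D; [|exact: intgZ|exact: intgZ].
have w1 : jweight (al + 1) (be + 1) 1 = 0.
  by rewrite /jweight subrr powR0 ?gt_eqF// mul0r.
have wN1 : jweight (al + 1) (be + 1) (-1) = 0.
  by rewrite /jweight subrr [X in _ * X]powR0 ?gt_eqF// mulr0.
rewrite w1 wN1 subrr (int11Z _ i1) (int11Z _ i2) => h.
suff : - (al + 1) * int11 (jweight al (be + 1)) + (be + 1) * int11 (jweight (al + 1) be) = 0.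
  by move: (int11 (jweight al (be + 1))) (int11 (jweight (al + 1) be)) => u v; lra.
apply: h => x xI; apply: continuousD; apply: continuousM; try exact: cst_continuous.
  exact: c1.
exact: c2.
Qed.

Lemma jweight_halves al be x : -1 < x < 1 ->
  jweight (al + 1) be x + jweight al (be + 1) x = 2 * jweight al be x.
Proof.
move=> xI; have := jweightDn al be 1 0 xI; have := jweightDn al be 0 1 xI.
by rewrite !addr0 !expr0 !expr1 => -> ->; ring.
Qed.

Lemma int11_jweight_halves al be : -1 < al -> -1 < be ->
  int11 (jweight (al + 1) be) + int11 (jweight al (be + 1)) = 2 * int11 (jweight al be).
Proof.
move=> al1 be1.
have [i0 _] := cintg_jweight al1 be1.
have [i1 _] := cintg_jweight al1 (ltr_wpDr ler01 be1 : -1 < be + 1).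
have [i2 _] := cintg_jweight (ltr_wpDr ler01 al1 : -1 < al + 1) be1.
rewrite -(int11D i2 i1) -(int11Z _ i0); apply: int11_eqoo; last exact: intgD.
exact: jweight_halves.
Qed.

Lemma int11_jweightSl al be : -1 < al -> -1 < be ->
  (al + be + 2) * int11 (jweight (al + 1) be) = 2 * (al + 1) * int11 (jweight al be).
Proof.
move=> al1 be1; have := jweight_FTC al1 be1; have := int11_jweight_halves al1 be1.
move: (int11 (jweight al be)) (int11 (jweight (al + 1) be)) (int11 (jweight al (be + 1))).
by move=> u v t; nra.
Qed.

Lemma int11_jweightSr al be : -1 < al -> -1 < be ->
  (al + be + 2) * int11 (jweight al (be + 1)) = 2 * (be + 1) * int11 (jweight al be).
Proof.
move=> al1 be1; have := jweight_FTC al1 be1; have := int11_jweight_halves al1 be1.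
move: (int11 (jweight al be)) (int11 (jweight (al + 1) be)) (int11 (jweight al (be + 1))).
by move=> u v t; nra.
Qed.

(** A quotient of two Beta integrals with the denominators multiplied out. *)
Lemma int11_jweight_nat al be m n : -1 < al -> -1 < be ->
  rf (al + be + 2) (m + n) * int11 (jweight (al + m%:R) (be + n%:R)) =
  2 ^+ (m + n) * rf (al + 1) m * rf (be + 1) n * int11 (jweight al be).
Proof.
move=> al1 be1.
have nat1 z k : -1 < z -> -1 < z + k%:R :> R by move=> h; rewrite ltr_wpDr.
elim: n => [|n ih].
  rewrite addn0 addr0 rf0 mulr1.
  elim: m => [|m ih]; first by rewrite addr0 !rf0 expr0 !mul1r.
  have := int11_jweightSl (nat1 _ m al1) be1.
  rewrite -(addrA al m%:R 1) natr1 !rfS exprS => h.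
  transitivity (rf (al + be + 2) m * ((al + m%:R + be + 2) * int11 (jweight (al + m.+1%:R) be))).
    by ring.
  rewrite h.
  transitivity (2 * (al + m%:R + 1) * (rf (al + be + 2) m * int11 (jweight (al + m%:R) be))); first by ring.
  by rewrite ih; ring.
have := int11_jweightSr (nat1 _ m al1) (nat1 _ n be1).
rewrite -(addrA be n%:R 1) natr1 addnS !rfS exprS => h.
transitivity (rf (al + be + 2) (m + n) *
   ((al + m%:R + (be + n%:R) + 2) * int11 (jweight (al + m%:R) (be + n.+1%:R)))).
  by rewrite natrD; ring.
rewrite h.
transitivity (2 * (be + n%:R + 1) * (rf (al + be + 2) (m + n) * int11 (jweight (al + m%:R) (be + n%:R)))); first by ring.
by rewrite ih; ring.
Qed.

(** Powers of X - 1 and X + 1 are kept because, up to sign, multiplying the weight by them only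
    shifts its exponents. *)
Definition jpol al be n : {poly R} :=
  \sum_(s < n.+1) (gbinom (n%:R + al) (n - s) * gbinom (n%:R + be) s / 2 ^+ n) *:
    (('X - 1%:P) ^+ s * ('X - (-1)%:P) ^+ (n - s)).

Lemma horner_jpol al be n x : (jpol al be n).[x] = jacobiP al be n x.
Proof.
rewrite /jpol /jacobiP horner_sum; apply: eq_bigr => s _.
rewrite hornerZ hornerM !horner_exp !hornerXsubC opprK.
have sn : (s <= n)%N by rewrite -ltnS.
have -> : 2 ^+ n = 2 ^+ s * 2 ^+ (n - s) :> R by rewrite -exprD subnKC.
by rewrite !expr_div_n invfM; ring.
Qed.

Lemma monic_factors n (s : 'I_n.+1) :
  (('X - 1%:P) ^+ s * ('X - (-1)%:P) ^+ (n - s) : {poly R}) \is monic.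
Proof. by rewrite monicMl monic_exp// monicXsubC. Qed.

Lemma size_factors n (s : 'I_n.+1) :
  size (('X - 1%:P) ^+ s * ('X - (-1)%:P) ^+ (n - s) : {poly R}) = n.+1.
Proof.
rewrite size_monicM ?monic_exp ?monicXsubC ?expf_neq0 ?polyXsubC_eq0//.
by rewrite !size_exp_XsubC addSn addnS /= subnKC// -ltnS.
Qed.

(** The leading coefficient, by the Vandermonde convolution; the argument is grouped as n + z so
    that [gbinom_rf] turns it into a rising factorial. *)
Definition jlead al be n : R := gbinom (n%:R + (n%:R + al + be)) n / 2 ^+ n.

Lemma size_jpol_le al be n : (size (jpol al be n) <= n.+1)%N.
Proof.
apply: (leq_trans (size_sum _ _ _)); apply/bigmax_leqP => s _.
by rewrite (leq_trans (size_scale_leq _ _))// size_factors.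
Qed.

Lemma coef_jpol al be n : (jpol al be n)`_n = jlead al be n.
Proof.
rewrite /jpol coef_sum /jlead.
have -> : n%:R + (n%:R + al + be) = (n%:R + al) + (n%:R + be) by ring.
rewrite -gbinom_Vandermonde mulr_suml; apply: eq_bigr => s _; rewrite coefZ.
have := monic_factors s; rewrite monicE lead_coefE size_factors /= => /eqP ->.
by rewrite mulr1.
Qed.

Lemma jleadE al be n : n`!%:R * 2 ^+ n * jlead al be n = rf (n%:R + al + be + 1) n.
Proof.
rewrite /jlead -gbinom_rf; have : (2 : R) ^+ n != 0 by rewrite expf_neq0.
by move=> h; field.
Qed.

Lemma jlead_gt0 al be n : -1 < al -> -1 < be -> 0 < jlead al be n.
Proof.
move=> al1 be1.
have c0 : 0 < n`!%:R * 2 ^+ n :> R by rewrite mulr_gt0 ?exprn_gt0 ?ltr0n ?fact_gt0.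
(* For n = 0 the base al + be + 1 may be negative, so the empty product is treated apart; for n > 0
   the base is positive. *)
rewrite -(pmulr_rgt0 _ c0) jleadE; case: n c0 => [|n] _; first by rewrite rf0.
by apply: rf_gt0; rewrite -natr1; have := ler0n R n; lra.
Qed.

Lemma size_jpol al be n : -1 < al -> -1 < be -> size (jpol al be n) = n.+1.
Proof.
move=> al1 be1; apply/eqP; rewrite eqn_leq size_jpol_le /= ltnNge.
apply/negP => /leq_sizeP /(_ n (leqnn _)); rewrite coef_jpol => /eqP.
by rewrite gt_eqF// jlead_gt0.
Qed.

Lemma horner_within p : {within I11, continuous (horner p)}.
Proof. by apply: within_continuous; exact: continuous_horner. Qed.

Lemma cintg_poly_jweight al be p : -1 < al -> -1 < be ->
  cintg (fun x => jweight al be x * p.[x]).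
Proof. by move=> al1 be1; apply: cintgM; [exact: horner_within|exact: cintg_jweight]. Qed.

(* The rising factorials produced by the moments combine with the binomials to
   constants, leaving an n-th finite difference of a polynomial of degree m. *)
Lemma int11_jpol_mono al be n m : -1 < al -> -1 < be ->
  n`!%:R * rf (al + be + 2) (n + m) *
    int11 (fun x => jweight al be x * ((jpol al be n * ('X - (-1)%:P) ^+ m).[x])) =
  2 ^+ m * rf (al + 1) n * rf (be + 1) n * int11 (jweight al be) * fdiff n m (be + 1 + n%:R).
Proof.
move=> al1 be1.
have nat1 z k : -1 < z -> -1 < z + k%:R :> R by move=> h; rewrite ltr_wpDr.
pose c (s : 'I_n.+1) := (-1) ^+ s * (gbinom (n%:R + al) (n - s) * gbinom (n%:R + be) s / 2 ^+ n).
have -> : int11 (fun x => jweight al be x * ((jpol al be n * ('X - (-1)%:P) ^+ m).[x])) =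
   \sum_(s < n.+1) c s * int11 (jweight (al + s%:R) (be + (n - s + m)%N%:R)).
  transitivity (int11 (fun x => \sum_(s < n.+1) c s * jweight (al + s%:R) (be + (n - s + m)%N%:R) x)).
    apply: int11_eqoo; last exact: (cintg_poly_jweight _ al1 be1).1.
    move=> x xI; rewrite hornerM horner_sum mulr_suml mulr_sumr; apply: eq_bigr => s _.
    rewrite jweightDn// hornerZ hornerM !horner_exp !hornerXsubC opprK /c.
    rewrite -(opprB 1 x) [(- (1 - x)) ^+ _]exprNn exprD (addrC x); ring.
  rewrite int11_sum => [|s _]; last first.
    by apply: intgZ; exact: (cintg_jweight (nat1 _ _ al1) (nat1 _ _ be1)).1.
  apply: eq_bigr => s _; rewrite int11Z//.
  exact: (cintg_jweight (nat1 _ _ al1) (nat1 _ _ be1)).1.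
rewrite /fdiff !mulr_sumr; apply: eq_bigr => s _.
have sn : (s <= n)%N by rewrite -ltnS.
have e1 : (n - s)`!%:R * gbinom (n%:R + al) (n - s) * rf (al + 1) s = rf (al + 1) n.
  have -> : n%:R + al = (n - s)%:R + (s%:R + al) by rewrite natrB//; ring.
  have -> : rf (al + 1) n = rf (al + 1) (s + (n - s)) by rewrite subnKC.
  rewrite gbinom_rf mulrC rfD; congr (_ * rf _ _); ring.
have e2 : s`!%:R * gbinom (n%:R + be) s * rf (be + 1) (n - s) = rf (be + 1) n.
  have -> : n%:R + be = s%:R + ((n - s)%:R + be) by rewrite natrB//; ring.
  have -> : rf (be + 1) n = rf (be + 1) (n - s + s) by rewrite subnK.
  rewrite gbinom_rf mulrC rfD; congr (_ * rf _ _); ring.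
have e3 : rf (be + 1) (n - s + m) = rf (be + 1) (n - s) * rf (be + 1 + n%:R - s%:R) m.
  by rewrite rfD natrB// addrA.
have e4 : n`!%:R = 'C(n, s)%:R * (s`!%:R * (n - s)`!%:R) :> R by rewrite -!natrM bin_fact.
have := int11_jweight_nat s (n - s + m) al1 be1; rewrite addnA subnKC// e3 => h.
transitivity (n`!%:R * c s * (rf (al + be + 2) (n + m) *
   int11 (jweight (al + s%:R) (be + (n - s + m)%N%:R)))); first by ring.
rewrite h -e1 -e2 e4 /c exprD.
have : (2 : R) ^+ n != 0 by rewrite expf_neq0.
by move=> n2; field.
Qed.

(** The pairing of the n-th Jacobi polynomial with one monic polynomial of degree n; by
    orthogonality every monic polynomial of that degree gives the same value. *)
Definition jnorm al be n : R :=
  int11 (fun x => jweight al be x * ((jpol al be n * ('X - (-1)%:P) ^+ n).[x])).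

Lemma jnormE al be n : -1 < al -> -1 < be ->
  rf (al + be + 2) (n + n) * jnorm al be n =
  2 ^+ n * rf (al + 1) n * rf (be + 1) n * int11 (jweight al be).
Proof.
move=> al1 be1; have := int11_jpol_mono n n al1 be1; rewrite fdiff_diag.
have f0 : n`!%:R != 0 :> R by rewrite pnatr_eq0 -lt0n fact_gt0.
by move=> h; apply: (mulfI f0); rewrite mulrA h mulrC.
Qed.

Lemma jnorm_gt0 al be n : -1 < al -> -1 < be -> 0 < jnorm al be n.
Proof.
move=> al1 be1; have r0 : 0 < rf (al + be + 2) (n + n) by apply: rf_gt0; lra.
rewrite -(pmulr_rgt0 _ r0) jnormE//.
rewrite !mulr_gt0 ?exprn_gt0 ?int11_jweight_gt0//; apply: rf_gt0; lra.
Qed.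

(** Consecutive leading coefficients are rising factorials whose bases differ by one. Their common
    factors cancel through [e], without dividing by the base, which may vanish. *)
Lemma jlead_rec al be n :
  jlead al be n.+1 * (2 * (n%:R + 1) * (n%:R + al + be + 1)) =
  jlead al be n * ((2 * n%:R + al + be + 1) * (2 * n%:R + al + be + 2)).
Proof.
have L := jleadE al be n; have L' := jleadE al be n.+1; move: L L'.
move: (jlead _ _ n) (jlead _ _ n.+1) => l l' L L'.
have c0 : 0 < n`!%:R * 2 ^+ n :> R by rewrite mulr_gt0 ?exprn_gt0 ?ltr0n ?fact_gt0.
apply: (@mulfI _ (n`!%:R * 2 ^+ n)); first by rewrite gt_eqF.
have e : forall z : R, rf z n * (z + n%:R) * (z + n.+1%:R) = z * rf (z + 1) n.+1.
  by move=> z; rewrite -rfSl !rfS.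
have {e} := e (n%:R + al + be + 1).
have -> : n%:R + al + be + 1 + 1 = n.+1%:R + al + be + 1 by rewrite -(natr1 n); ring.
rewrite -L -L' factS natrM exprS -(natr1 n); move: (n%:R : R) (n`!%:R : R) (2 ^+ n : R).
move=> t f g e.
transitivity ((t + al + be + 1) * ((t + 1) * f * (2 * g) * l')); first by ring.
by rewrite -e; ring.
Qed.

Lemma jnorm_rec al be n : -1 < al -> -1 < be ->
  jnorm al be n.+1 * ((2 * n%:R + al + be + 2) * (2 * n%:R + al + be + 3)) =
  jnorm al be n * (2 * (n%:R + al + 1) * (n%:R + be + 1)).
Proof.
move=> al1 be1; have := jnormE n al1 be1; have := jnormE n.+1 al1 be1.
have c0 : 0 < rf (al + be + 2) (n + n) by apply: rf_gt0; lra.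
rewrite addnS addSn !rfS exprS natrD -(natr1 (n + n)) natrD.
move: (jnorm _ _ n) (jnorm _ _ n.+1) (int11 _) c0 => l l' B.
move: (rf _ (n + n)) (rf _ n) (rf _ n) (n%:R : R) (2 ^+ n : R) => r1 r2 r3 t g c0 N2 N1.
apply: (@mulfI _ r1); first by rewrite gt_eqF.
transitivity (r1 * (al + be + 2 + (t + t)) * (al + be + 2 + (t + t + 1)) * l'); first by ring.
rewrite N2; transitivity (2 * (t + al + 1) * (t + be + 1) * (r1 * l)); last by ring.
by rewrite N1; ring.
Qed.

(** In the expansion of q in powers of X + 1 only the n-th survives, since the moments of lower
    order carry a vanishing finite difference. Orthogonality and norms both follow. *)
Lemma int11_jpol al be n q : -1 < al -> -1 < be -> (size q <= n.+1)%N ->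
  int11 (fun x => jweight al be x * ((jpol al be n * q).[x])) = q`_n * jnorm al be n.
Proof.
move=> al1 be1 sq.
have sX i : size (('X - (-1)%:P) ^+ i : {poly R}) = i.+1.
  by rewrite size_exp_XsubC.
have [c [-> _]] := poly_expand sX sq.
rewrite -[X in _ = X * _](_ : c n = _); last first.
  rewrite coef_sum big_ord_recr /= big1 ?add0r => [|i _].
    rewrite coefZ; have : (('X - (-1)%:P) ^+ n : {poly R}) \is monic.
      by rewrite monic_exp// monicXsubC.
    by rewrite monicE lead_coefE sX /= => /eqP ->; rewrite mulr1.
  by rewrite coefZ nth_default ?mulr0// sX.
have ii i := (cintg_poly_jweight (jpol al be n * ('X - (-1)%:P) ^+ i) al1 be1).1.
transitivity (int11 (fun x => \sum_(i < n.+1) c i * (jweight al be x * (jpol al be n * ('X - (-1)%:P) ^+ i).[x]))).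
  apply: int11_eq => x _; rewrite mulr_sumr horner_sum mulr_sumr; apply: eq_bigr => i _.
  by rewrite -scalerAr hornerZ; ring.
rewrite int11_sum => [|i _]; last exact: intgZ.
rewrite big_ord_recr /= int11Z// big1 ?add0r// => i _.
rewrite int11Z//; apply/eqP; rewrite mulf_eq0; apply/orP; right.
have := int11_jpol_mono n i al1 be1; rewrite fdiff_lt ?mulr0// => /eqP.
rewrite !mulf_eq0 pnatr_eq0 gtn_eqF ?fact_gt0//= => /orP[|//].
by rewrite gt_eqF// rf_gt0//; lra.
Qed.

Lemma jacobi_hE al be n : -1 < al -> -1 < be ->
  jacobi_h al be n = jlead al be n * jnorm al be n.
Proof.
move=> al1 be1; rewrite -coef_jpol -int11_jpol ?size_jpol_le//.
by apply: int11_eq => x _; rewrite hornerM !horner_jpol; ring.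
Qed.

Lemma jacobi_h_gt0 al be n : -1 < al -> -1 < be -> 0 < jacobi_h al be n.
Proof. by move=> al1 be1; rewrite jacobi_hE// mulr_gt0 ?jlead_gt0 ?jnorm_gt0. Qed.

Lemma int11_jpol_orth al be i j : -1 < al -> -1 < be ->
  int11 (fun x => jweight al be x * ((jpol al be i * jpol al be j).[x])) =
  (i == j)%:R * jacobi_h al be i.
Proof.
move=> al1 be1; have [ij|ji|->] := ltngtP i j.
- rewrite mul0r mulrC int11_jpol//; last by rewrite (leq_trans (size_jpol_le _ _ _))// ltnW.
  by rewrite nth_default ?mul0r// (leq_trans (size_jpol_le _ _ _)).
- rewrite mul0r int11_jpol//; last by rewrite (leq_trans (size_jpol_le _ _ _))// ltnW.
  by rewrite nth_default ?mul0r// (leq_trans (size_jpol_le _ _ _)).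
- by rewrite int11_jpol ?size_jpol_le// coef_jpol mul1r jacobi_hE.
Qed.

End Jacobi.

(** * The functions phi_j and the dual basis of the eps phi_k *)

Section JOE.
Variable R : realType.
Local Notation I11 := [set` `[(-1)%R : R, 1%R]].
Variables a b : R.
Hypotheses (a2 : -2 < a) (b2 : -2 < b).
Implicit Types (x : R) (p q : {poly R}) (i j k n N : nat).

Local Notation phi := (phi1 a b).
Local Notation w := (jweight (a / 2) (b / 2)).
Local Notation h := (jacobi_h (a + 1) (b + 1)).

Let a1 : -1 < a + 1. Proof. have := a2; lra. Qed.
Let b1 : -1 < b + 1. Proof. have := b2; lra. Qed.
Let ha1 : -1 < a / 2. Proof. have := a2; lra. Qed.
Let hb1 : -1 < b / 2. Proof. have := b2; lra. Qed.
Let ha0 : 0 < a / 2 + 1. Proof. have := a2; lra. Qed.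
Let hb0 : 0 < b / 2 + 1. Proof. have := b2; lra. Qed.

Definition npol j : {poly R} := (Num.sqrt (h j))^-1 *: jpol (a + 1) (b + 1) j.

Lemma sqrt_h_gt0 j : 0 < Num.sqrt (h j).
Proof. by rewrite sqrtr_gt0 jacobi_h_gt0. Qed.

Lemma phi_npol j x : phi j x = w x * (npol j).[x].
Proof. by rewrite /phi1 /npol hornerZ horner_jpol /jweight; ring. Qed.

Lemma size_npol j : size (npol j) = j.+1.
Proof. by rewrite size_scale ?size_jpol// invr_eq0 gt_eqF ?sqrt_h_gt0. Qed.

Definition nlead j : R := jlead (a + 1) (b + 1) j / Num.sqrt (h j).

Lemma coef_npol j : (npol j)`_j = nlead j.
Proof. by rewrite coefZ coef_jpol mulrC. Qed.

Lemma nlead_gt0 j : 0 < nlead j.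
Proof. by rewrite divr_gt0 ?sqrt_h_gt0 ?jlead_gt0. Qed.

(** As h_j is the leading coefficient times [jnorm], squaring removes the root and leaves two
    quantities with first-order recurrences. *)
Lemma sqr_nlead j : nlead j ^+ 2 = jlead (a + 1) (b + 1) j / jnorm (a + 1) (b + 1) j.
Proof.
rewrite /nlead exprMn exprVn sqr_sqrtr ?ltW ?jacobi_h_gt0// jacobi_hE//.
have := jlead_gt0 j a1 b1; have := jnorm_gt0 j a1 b1 => h1 h2.
by field; rewrite !gt_eqF.
Qed.

Lemma cintg_wpoly q : cintg (fun x => w x * q.[x]).
Proof. exact: cintg_poly_jweight. Qed.

Lemma cintg_phi j : cintg (phi j).
Proof.
by rewrite (_ : phi j = fun x => w x * (npol j).[x]) ?funeqE => [|x]; [exact: cintg_wpoly|exact: phi_npol].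
Qed.

Definition Fphi j x := (1 - x ^+ 2) * phi j x.

(** In this form both exponents are positive, which gives continuity up to the ends. *)
Lemma FphiE j x : -1 <= x <= 1 ->
  Fphi j x = (npol j).[x] * jweight (a / 2 + 1) (b / 2 + 1) x.
Proof.
move=> /andP[x1 x2]; rewrite /Fphi phi_npol.
have ha : a / 2 + 1 != 0 by rewrite gt_eqF.
have hb : b / 2 + 1 != 0 by rewrite gt_eqF.
have [->|n1] := eqVneq x 1.
  by rewrite expr1n subrr mul0r /jweight subrr powR0// mul0r mulr0.
have [->|n2] := eqVneq x (-1).
  by rewrite sqrrN expr1n subrr mul0r /jweight subrr [0 `^ (b / 2 + 1)]powR0// !mulr0.
have xI : -1 < x < 1 by rewrite !lt_neqAle x1 x2 n1 eq_sym n2.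
by rewrite (jweightDn _ _ 1 1 xI); ring.
Qed.

Lemma Fphi_within j : {within I11, continuous (Fphi j)}.
Proof.
apply: (within_ext (F := fun x => (npol j).[x] * jweight (a / 2 + 1) (b / 2 + 1) x)).
  by move=> x xI; rewrite FphiE.
by apply: within_mul; [exact: horner_within|exact: jweight_within].
Qed.

(** The polynomial factor in (p (1 - x^2) w)' = w [Dpol p]. It equals (1 - x^2) p' + ((b/2 + 1)(1 -
    x) - (a/2 + 1)(1 + x)) p, arranged so that coefficients can be read off. *)
Definition Dpol p : {poly R} :=
  p^`() - 'X * ('X * p^`()) + (b / 2 - a / 2) *: p - (a / 2 + b / 2 + 2) *: ('X * p).

Lemma derive_Fphi j x : -1 < x < 1 ->
  is_derive x 1 (Fphi j) (w x * (Dpol (npol j)).[x]).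
Proof.
move=> xI.
have d := is_derive_mul (is_derive_poly (npol j) x) (derive_jweight (a / 2) (b / 2) xI).
apply: (near_eq_is_derive _ (is_derive_eq d _)) => //.
- near=> t; rewrite FphiE//.
  have /andP[/ltW -> /ltW ->//] : -1 < t < 1 by near: t; exact: near_oo.
- have := jweightDn (a / 2) (b / 2) 1 1 xI; have := jweightDn (a / 2) (b / 2) 0 1 xI.
  have := jweightDn (a / 2) (b / 2) 1 0 xI; rewrite !addr0 => -> -> ->.
  rewrite /Dpol !(hornerD, hornerN, hornerZ, hornerM, hornerX); ring.
Unshelve. all: by end_near. Qed.

Lemma Fphi1 j : Fphi j 1 = 0.
Proof. by rewrite /Fphi expr1n subrr mul0r. Qed.

Lemma FphiN1 j : Fphi j (-1) = 0.
Proof. by rewrite /Fphi sqrrN expr1n subrr mul0r. Qed.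

Lemma epsf_Dpol j x : x \in I11 ->
  epsf (fun t => w t * (Dpol (npol j)).[t]) x = Fphi j x.
Proof.
apply: epsf_FTC; [exact: cintg_wpoly|exact: Fphi_within| |exact: Fphi1|exact: FphiN1].
exact: derive_Fphi.
Qed.

(** The product carries w^2 (1 - x^2), the orthogonality weight of the p_j. This factorization is
    used only inside the interval. *)
Lemma int11_phi_Fphi i j : int11 (fun x => phi i x * Fphi j x) = (i == j)%:R.
Proof.
transitivity ((Num.sqrt (h i))^-1 * (Num.sqrt (h j))^-1 *
   int11 (fun x => jweight (a + 1) (b + 1) x * (jpol (a + 1) (b + 1) i * jpol (a + 1) (b + 1) j).[x])).
  rewrite -int11Z; last exact: (cintg_poly_jweight _ a1 b1).1.
  apply: int11_eqoo; last first.
    by have [c _] := cintgM (@Fphi_within j) (cintg_phi i); exact: c.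
  move=> x xI; rewrite FphiE; last by case/andP: xI => /ltW -> /ltW ->.
  rewrite (jweightDn _ _ 1 1 xI) phi_npol /npol !hornerZ hornerM.
  have -> : jweight (a + 1) (b + 1) x = w x * w x * ((1 - x) * (1 + x)).
    have := jweightDn a b 1 1 xI; rewrite /= => ->.
    rewrite /jweight !expr1.
    have h1 : 1 - x != 0 by rewrite gt_eqF//; case/andP: xI; lra.
    have h2 : 1 + x != 0 by rewrite gt_eqF//; case/andP: xI; lra.
    have e1 : (1 - x) `^ a = (1 - x) `^ (a / 2) * (1 - x) `^ (a / 2).
      by rewrite -powRD -?splitr// h1 implybT.
    have e2 : (1 + x) `^ b = (1 + x) `^ (b / 2) * (1 + x) `^ (b / 2).
      by rewrite -powRD -?splitr// h2 implybT.
    by rewrite e1 e2; ring.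
  by ring.
rewrite int11_jpol_orth//; have [->|_] := eqVneq i j; last by rewrite mul0r mulr0.
rewrite mul1r -invfM -expr2 sqr_sqrtr ?ltW ?jacobi_h_gt0// mulVf//.
by rewrite gt_eqF// jacobi_h_gt0.
Qed.

Lemma size_Dpol p n : (size p <= n.+1)%N -> (size (Dpol p) <= n.+2)%N.
Proof.
move=> sp; apply/leq_sizeP => m nm.
have pz k : (n < k)%N -> p`_k = 0 by move=> nk; rewrite nth_default// (leq_trans sp).
rewrite /Dpol !coefB coefD coefB !coefZ !coefXM !coef_deriv.
case: m nm => [//|[//|m]] nm /=; rewrite !pz ?mul0rn ?mulr0 ?subr0 ?addr0//; lia.
Qed.

(** The term -x^2 p' contributes -n and the last term of [Dpol] the rest; this is the linear factor
    in [CN1E]. *)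
Lemma coef_Dpol p n : (size p <= n.+1)%N ->
  (Dpol p)`_n.+1 = - (n%:R + a / 2 + b / 2 + 2) * p`_n.
Proof.
move=> sp.
have pz k : (n < k)%N -> p`_k = 0 by move=> nk; rewrite nth_default// (leq_trans sp).
rewrite /Dpol !coefB coefD coefB !coefZ !coefXM !coef_deriv.
rewrite /= (pz n.+1)// (pz n.+2)//; case: n sp pz => [|n] sp pz /=; first by rewrite !mul0rn; ring.
by rewrite !mul0rn -mulr_natr; ring.
Qed.

Definition Eform i k : R := int11 (fun x => phi i x * epsf (phi k) x).

Lemma Eform_skew i k : Eform i k = - Eform k i.
Proof. exact: int11_epsf_skew (cintg_phi i) (cintg_phi k). Qed.

(* Here [t = N - 1]; [l, l'] and [s, s'] are consecutive values of [jlead] and [jnorm]. *)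
Lemma CN_algebra (t l l' s s' : R) : 1 <= t -> 0 < s -> 0 < l -> 0 < s' -> 0 < l' ->
  s' * ((2 * t + (a + 1) + (b + 1) + 2) * (2 * t + (a + 1) + (b + 1) + 3)) =
    s * (2 * (t + (a + 1) + 1) * (t + (b + 1) + 1)) ->
  l' * (2 * (t + 1) * (t + (a + 1) + (b + 1) + 1)) =
    l * ((2 * t + (a + 1) + (b + 1) + 1) * (2 * t + (a + 1) + (b + 1) + 2)) ->
  (t + 1) * (t + 1 + a + 1) * (t + 1 + b + 1) * (t + 1 + a + b + 2) /
    ((2 * (t + 1) + a + b + 1) * (2 * (t + 1) + a + b + 3)) =
  (t + a / 2 + b / 2 + 2) ^+ 2 * (l / s) / (l' / s').
Proof.
move=> t1 s0 l0 s0' l0' hs hl; have := a2; have := b2 => b2' a2'.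
(* All factors that contain 2 t become T - 1, T and T + 1, and the squared factor is T / 2. The
   existential makes T opaque for [field]. *)
have [T TE] : exists T, T = 2 * t + a + b + 4 by eexists.
have T1 : 1 < T by lra.
have D0 : 0 < t + a + b + 3 by lra.
have s'E : s' = s * (2 * (t + a + 2) * (t + b + 2)) / (T * (T + 1)).
  apply: (@mulIf _ (T * (T + 1))); first by rewrite gt_eqF// mulr_gt0//; lra.
  rewrite divfK; last by rewrite gt_eqF// mulr_gt0//; lra.
  have -> : T * (T + 1) = (2 * t + (a + 1) + (b + 1) + 2) * (2 * t + (a + 1) + (b + 1) + 3).
    by rewrite TE; ring.
  by rewrite hs; ring.
have l'E : l' = l * ((T - 1) * T) / (2 * (t + 1) * (t + a + b + 3)).
  apply: (@mulIf _ (2 * (t + 1) * (t + a + b + 3))); first by rewrite gt_eqF// !mulr_gt0//; lra.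
  rewrite divfK; last by rewrite gt_eqF// !mulr_gt0//; lra.
  have -> : (T - 1) * T = (2 * t + (a + 1) + (b + 1) + 1) * (2 * t + (a + 1) + (b + 1) + 2).
    by rewrite TE; ring.
  by rewrite -hl; ring.
have -> : 2 * (t + 1) + a + b + 1 = T - 1 by rewrite TE; ring.
have -> : 2 * (t + 1) + a + b + 3 = T + 1 by rewrite TE; ring.
have -> : t + a / 2 + b / 2 + 2 = T / 2 by rewrite TE; field.
rewrite s'E l'E; clear TE hs hl s'E l'E.
have [n1 n2 n3] : [/\ T - 1 != 0, T + 1 != 0 & T != 0] by split; rewrite gt_eqF//; lra.
have [n4 n5 n6] : [/\ t + 1 != 0, t + a + b + 3 != 0 & s != 0] by split; rewrite gt_eqF//; lra.
have [n7 n8 n9] : [/\ l != 0, t + a + 2 != 0 & t + b + 2 != 0] by split; rewrite gt_eqF//; lra.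
field; rewrite ?n1 ?n2 ?n3 ?n4 ?n5 ?n6 ?n7 ?n8 ?n9//=.
Qed.

(** Both sides are nonnegative, so it suffices to compare squares, where the two recurrences apply.
    The right side is minus the phi_N coefficient of F_{N-1}' / w in the orthonormal basis. *)
Lemma CN1E N : (2 <= N)%N ->
  CN1 a b N = (N.-1%:R + a / 2 + b / 2 + 2) * nlead N.-1 / nlead N.
Proof.
case: N => [//|m]; rewrite ltnS => m1 /=.
have m1R : 1 <= m%:R :> R by rewrite ler1n.
have kp := nlead_gt0 m; have kp' := nlead_gt0 m.+1.
rewrite /CN1; set Y := (X in _ = X).
have Y0 : 0 <= Y.
  apply: divr_ge0; last exact: ltW; apply: mulr_ge0; last exact: ltW.
  by have := a2; have := b2; lra.
rewrite -[RHS](ger0_norm Y0) -sqrtr_sqr; congr Num.sqrt.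
have -> : Y ^+ 2 = (m%:R + a / 2 + b / 2 + 2) ^+ 2 * nlead m ^+ 2 / nlead m.+1 ^+ 2.
  by rewrite /Y expr_div_n exprMn.
rewrite !sqr_nlead.
have := jlead_rec (a + 1) (b + 1) m; have := jnorm_rec m a1 b1.
have := jlead_gt0 m.+1 a1 b1; have := jnorm_gt0 m.+1 a1 b1.
have := jlead_gt0 m a1 b1; have := jnorm_gt0 m a1 b1.
move: (jlead _ _ m) (jlead _ _ m.+1) (jnorm _ _ m) (jnorm _ _ m.+1) => l l' s s'.
by rewrite -(natr1 m); exact: CN_algebra.
Qed.

Lemma epsf_sum n (c : nat -> R) (g : nat -> R -> R) x : (forall i, intg (g i)) ->
  epsf (fun t => \sum_(i < n) c i * g i t) x = \sum_(i < n) c i * epsf (g i) x.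
Proof.
move=> ig; rewrite /epsf.
transitivity (int11 (fun y => \sum_(i < n) c i * (epsk x y * g i y))).
  by apply: int11_eq => y _; rewrite mulr_sumr; apply: eq_bigr => i _; rewrite mulrCA.
rewrite int11_sum => [|i _]; last by apply: intgZ; exact: intg_epsk.
by apply: eq_bigr => i _; rewrite int11Z//; exact: intg_epsk.
Qed.

Lemma Fphi_expand N j : (j < N)%N -> exists c : nat -> R,
  [/\ forall x, x \in I11 -> Fphi j x = \sum_(k < N.+1) c k * epsf (phi k) x
   & c N * nlead N = (Dpol (npol j))`_N].
Proof.
move=> jN.
have sq : (size (Dpol (npol j)) <= N.+1)%N.
  by apply: (leq_trans (size_Dpol (n := j) _)); rewrite ?size_npol.
have [c [cE cN]] := poly_expand size_npol sq.
exists c; split => [x xI|]; last by rewrite -coef_npol.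
rewrite -epsf_Dpol// -epsf_sum; last by move=> k; have [] := cintg_phi k.
congr epsf; apply/funext => t; rewrite cE horner_sum mulr_sumr.
by apply: eq_bigr => k _; rewrite hornerZ phi_npol mulrCA.
Qed.

Lemma JOE_dual N : (2 <= N)%N -> ~~ odd N -> exists c : nat -> nat -> R,
  (forall j x, (j < N)%N -> x \in I11 ->
     Fphi j x + (j == N.-1)%:R * CN1 a b N * epsf (phi N) x = \sum_(k < N) c j k * epsf (phi k) x) /\
  (forall i j, (i < N)%N -> (j < N)%N -> \sum_(k < N) Eform i k * c j k = (i == j)%:R).
Proof.
move=> N2 Neven.
have [c hc] : exists c : nat -> nat -> R, forall j, (j < N)%N ->
  (forall x, x \in I11 -> Fphi j x = \sum_(k < N.+1) c j k * epsf (phi k) x)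
   /\ c j N * nlead N = (Dpol (npol j))`_N.
  have : forall j, exists cj : nat -> R, (j < N)%N ->
    (forall x, x \in I11 -> Fphi j x = \sum_(k < N.+1) cj k * epsf (phi k) x)
   /\ cj N * nlead N = (Dpol (npol j))`_N.
    move=> j; have [jN|_] := ltnP j N; last by exists (fun=> 0).
    by have [cj [h1 h2]] := Fphi_expand jN; exists cj.
  by move=> /choice[c hc]; exists c.
have ie k : {within I11, continuous (epsf (phi k))}.
  by apply: epsf_within; have [] := cintg_phi k.
(* The expansion of F_j is paired with phi_i. The index i is unrestricted: i = N gives the zero
   needed for the radical. *)
have delta i j : (j < N)%N -> \sum_(k < N.+1) Eform i k * c j k = (i == j)%:R.
  move=> jN; rewrite -int11_phi_Fphi.
  transitivity (int11 (fun x => \sum_(k < N.+1) c j k * (phi i x * epsf (phi k) x))).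
    rewrite int11_sum => [|k _]; last by apply: intgZ; have [] := cintgM (ie k) (cintg_phi i).
    apply: eq_bigr => k _; rewrite int11Z 1?mulrC//.
    by have [] := cintgM (ie k) (cintg_phi i).
  apply: int11_eq => x xI; rewrite (hc j jN).1// mulr_sumr.
  by apply: eq_bigr => k _; rewrite mulrCA.
(* The skew form on the odd-dimensional span of phi_0, ..., phi_N is degenerate,
   and its radical pairs to zero with every Fphi_j, j < N, hence is spanned by phi_N. *)
have EN i : (i < N)%N -> Eform i N = 0.
  move=> iN.
  pose A : 'M[R]_N.+1 := \matrix_(i, k) Eform i k.
  have At : A^T = - A by apply/matrixP => i' k; rewrite !mxE Eform_skew.
  have dA : \det A = 0.
    have := congr1 determinant At; rewrite det_tr -scaleN1r detZ exprS -signr_odd (negbTE Neven).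
    by move: (\det A) => d; rewrite expr0 mulr1 mulN1r; lra.
  have /det0P[u u0 uA] : \det A == 0 by rewrite dA.
  have uE (k : 'I_N.+1) : \sum_(i' < N.+1) u 0 i' * Eform i' k = 0.
    have := congr1 (fun B : 'rV_N.+1 => B 0 k) uA; rewrite !mxE => h.
    by rewrite -[RHS]h; apply: eq_bigr => i' _; rewrite mxE.
  have uz (j : 'I_N.+1) : (j < N)%N -> u 0 j = 0.
    move=> jN.
    have -> : u 0 j = \sum_(i' < N.+1) u 0 i' * (i' == j :> nat)%:R.
      rewrite (bigD1 j)//= eqxx mulr1 big1 ?addr0// => i' nij.
      by rewrite (_ : _ == _ :> nat = false) ?mulr0//; apply/negbTE.
    transitivity (\sum_(i' < N.+1) \sum_(k < N.+1) u 0 i' * Eform i' k * c j k).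
      by apply: eq_bigr => i' _; rewrite -(delta _ _ jN) mulr_sumr; apply: eq_bigr => k _; rewrite mulrA.
    rewrite exchange_big /= big1// => k _.
    by rewrite -mulr_suml uE mul0r.
  have uN : u 0 ord_max != 0.
    apply: contraNneq u0 => uN; apply/eqP/rowP => j; rewrite mxE.
    have [jN|Nj] := ltnP j N; first exact: uz.
    by rewrite (_ : j = ord_max)//; apply/val_inj/eqP; rewrite eqn_leq Nj -ltnS ltn_ord.
  have iN1 : (i < N.+1)%N by exact: ltnW.
  have /eqP := uE (Ordinal iN1); rewrite big_ord_recr /= big1 ?add0r => [|i' _]; last first.
    by rewrite uz ?mul0r//=.
  by rewrite mulf_eq0 (negbTE uN) orFb Eform_skew oppr_eq0 => /eqP.
exists c; split => [j x jN xI|i j iN jN]; last first.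
  by rewrite -delta// big_ord_recr /= EN// mul0r addr0.
have [-> // cN] := hc j jN.
(* Only the term k = N must cancel: for j < N - 1 it vanishes by degree, and for j = N - 1 its
   coefficient is -C_N. *)
rewrite big_ord_recr /= -addrA -[RHS]addr0; congr (_ + _).
have nN := nlead_gt0 N.
have [jE|jne] := eqVneq j N.-1; last first.
  rewrite mul0r mul0r addr0.
  have : c j N * nlead N = 0.
    rewrite cN nth_default// (leq_trans (size_Dpol (n := j) _)) ?size_npol//.
    by rewrite ltn_neqAle; apply/andP; split; [apply: contraNneq jne => <-|].
  by move/eqP; rewrite mulf_eq0 (gt_eqF nN) orbF => /eqP ->; rewrite mul0r.
rewrite mul1r -mulrDl.
have -> : c j N = - CN1 a b N.
  have jS : N = j.+1 by rewrite jE prednK// ltnW.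
  apply: (@mulIf _ (nlead N)); first by rewrite gt_eqF.
  rewrite cN {1}jS coef_Dpol ?size_npol// coef_npol CN1E// -jE.
  by rewrite -mulNr divfK ?gt_eqF// mulNr.
by rewrite addNr mul0r.
Qed.

End JOE.

(** * Determinants and unnormalized Pfaffians *)

Section DetOnePlus.
Local Close Scope classical_set_scope.

(** Filling the rows outside the image with identity rows puts minors of all orders into one r by r
    shape. Such a row is expanded away by induction; if [k] is onto, rows and columns undergo the
    same permutation and the signs cancel. *)
Lemma det_principal_inj (F : comNzRingType) n r (k : 'I_n -> 'I_r) (B : 'M[F]_r) :
  injective k ->
  \det (\matrix_(i, j) B (k i) (k j)) =
  \det (\matrix_(i, j) (if i \in codom k then B i j else (i == j)%:R)).
Proof.
elim: r n k B => [|r ih] n k B kinj.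
  case: n k kinj => [|n] k kinj; last by case: (k ord0).
  by congr determinant; apply/matrixP => -[].
have [/forallP cod|/forallPn[i0 i0k]] := boolP [forall i, i \in codom k].
  have nE : n = r.+1.
    rewrite -[n]card_ord -(card_codom kinj) -[RHS]card_ord; apply: eq_card => i.
    by rewrite cod.
  subst n.
  have -> : (\matrix_(i, j) (if i \in codom k then B i j else (i == j)%:R)) = B.
    by apply/matrixP => i j; rewrite mxE cod.
  pose s := perm kinj.
  have -> : \matrix_(i, j) B (k i) (k j) = row_perm s (col_perm s B).
    by apply/matrixP => i j; rewrite !mxE !permE.
  rewrite row_permE col_permE !det_mulmx !det_perm odd_permV.
  by rewrite mulrCA -signr_addb addbb mulr1.
rewrite (expand_det_row _ i0) (bigD1 i0)//= big1 ?addr0; last first.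
  by move=> j ji; rewrite mxE (negbTE i0k) eq_sym (negbTE ji) mul0r.
rewrite mxE (negbTE i0k) eqxx mul1r /cofactor addnn -signr_odd odd_double mul1r.
have k'P i : {j | k i = lift i0 j}.
  have : i0 != k i by apply: contraNneq i0k => ->; exact: codom_f.
  by move=> /unlift_some[j -> _]; exists j.
pose k' i := sval (k'P i).
have kE i : k i = lift i0 (k' i) by exact: (svalP (k'P i)).
have k'inj : injective k' by move=> i j e; apply: kinj; rewrite !kE e.
transitivity (\det (\matrix_(i, j) (row' i0 (col' i0 B)) (k' i) (k' j))).
  by congr determinant; apply/matrixP => i j; rewrite !mxE !kE.
rewrite ih//; congr determinant; apply/matrixP => i j; rewrite !mxE.
have -> : (lift i0 i \in codom k) = (i \in codom k').
  apply/codomP/codomP => -[t e]; exists t; first by apply: (@lift_inj _ i0); rewrite e kE.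
  by rewrite kE e.
by rewrite (inj_eq (@lift_inj _ i0)).
Qed.

(** Distributing each product over rows, S collects the rows in which the entry of B is chosen. *)
Lemma det_one_plus (F : comNzRingType) r (B : 'M[F]_r) :
  \det (1%:M + B) =
  \sum_(S : {set 'I_r}) \det (\matrix_(i, j) (if i \in S then B i j else (i == j)%:R)).
Proof.
rewrite /determinant exchange_big /=; apply: eq_bigr => s _.
rewrite -mulr_sumr; congr (_ * _).
under eq_bigr do rewrite !mxE addrC.
rewrite bigA_distr; apply: eq_bigr => S _; apply: eq_bigr => i _.
by rewrite !mxE.
Qed.

(** A family with a repetition has equal rows, and each set of n indices is the image of n!
    injective families. *)
Lemma sum_det_ffun (F : comNzRingType) n r (B : 'M[F]_r) :
  \sum_(k : {ffun 'I_n -> 'I_r}) \det (\matrix_(i, j) B (k i) (k j)) =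
  n`!%:R * \sum_(S : {set 'I_r} | #|S| == n)
     \det (\matrix_(i, j) (if i \in S then B i j else (i == j)%:R)).
Proof.
rewrite (bigID (fun k : {ffun 'I_n -> 'I_r} => injectiveb k)) /= addrC big1 ?add0r; last first.
  move=> k /injectivePn[i1 [i2 n12 e12]].
  by apply: (determinant_alternate n12) => j; rewrite !mxE e12.
rewrite (partition_big (fun k : {ffun 'I_n -> 'I_r} => finset (fun x => x \in codom k))
   (fun S : {set 'I_r} => #|S| == n)) /=; last first.
  by move=> k /injectiveP kinj; rewrite cardsE card_codom// card_ord.
rewrite mulr_sumr; apply: eq_bigr => S /eqP cS.
set D := (X in _ = _ * X).
transitivity (\sum_(k : {ffun 'I_n -> 'I_r} | injectiveb k && (finset (fun x => x \in codom k) == S)) D).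
  apply: eq_bigr => k /andP[/injectiveP kinj /eqP kS].
  rewrite det_principal_inj//; congr determinant; apply/matrixP => i j; rewrite !mxE.
  by rewrite -kS inE.
rewrite sumr_const mulr_natl; congr (_ *+ _).
have := @card_inj_ffuns_on 'I_n 'I_r (mem S).
rewrite card_ord cS ffactnn => <-; apply: eq_card => k; rewrite inE [LHS]/in_mem /= andbC.
have [kinj|] := boolP (injectiveb k); last by rewrite !andbF.
rewrite !andbT; apply/eqP/ffun_onP => [<- i|kS]; first by rewrite inE codom_f.
apply/eqP; rewrite eqEcard cardsE (card_codom (injectiveP _ kinj)) card_ord cS leqnn andbT.
by apply/fintype.subsetP => x; rewrite inE => /codomP[i ->].
Qed.

Lemma det_one_plus_series (F : numFieldType) r (B : 'M[F]_r) :
  \sum_(n < r.+1) n`!%:R^-1 *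
     \sum_(k : {ffun 'I_n -> 'I_r}) \det (\matrix_(i, j) B (k i) (k j)) = \det (1%:M + B).
Proof.
rewrite det_one_plus.
under eq_bigr => n _.
  rewrite sum_det_ffun mulKf; last by rewrite pnatr_eq0 -lt0n fact_gt0.
  over.
have cS (S : {set 'I_r}) : (#|S| < r.+1)%N by rewrite ltnS -[X in (_ <= X)%N]card_ord max_card.
by rewrite [RHS](partition_big (fun S : {set 'I_r} => Ordinal (cS S)) predT).
Qed.

Lemma sum_det_ffun_gt (F : comNzRingType) n r (B : 'M[F]_r) : (r < n)%N ->
  \sum_(k : {ffun 'I_n -> 'I_r}) \det (\matrix_(i, j) B (k i) (k j)) = 0.
Proof.
move=> rn; rewrite sum_det_ffun big1 ?mulr0// => S /eqP cS.
by have := max_card (mem S); rewrite cS card_ord leqNgt rn.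
Qed.

End DetOnePlus.

(** * Sums of Pfaffian type and the normal form of skew matrices *)

Section Phi.
Local Close Scope classical_set_scope.

Lemma enc_proof n (p : 'I_n * bool) : (p.1.*2 + p.2 < n.*2)%N.
Proof. by case: p => [[l ln]] [] /=; lia. Qed.

(** Positions 2 l and 2 l + 1 form the l-th pair of the matching used in [Phi]. *)
Definition enc n (p : 'I_n * bool) : 'I_n.*2 := Ordinal (enc_proof p).

Lemma dec_proof n (i : 'I_n.*2) : (i./2 < n)%N.
Proof. by case: i => i /=; lia. Qed.

Definition dec n (i : 'I_n.*2) : 'I_n * bool := (Ordinal (dec_proof i), odd i).

Lemma decK n : cancel (@dec n) (@enc n).
Proof. by move=> i; apply: val_inj => /=; rewrite addnC odd_double_half. Qed.

Lemma encK n : cancel (@enc n) (@dec n).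
Proof.
move=> [l b]; rewrite /dec; congr (_, _).
  by apply: val_inj => /=; rewrite addnC half_bit_double.
by rewrite /= oddD odd_double oddb.
Qed.

Definition ev n (l : 'I_n) := enc (l, false).
Definition od n (l : 'I_n) := enc (l, true).

Lemma big_enc (T : Type) (idx : T) (op : Monoid.com_law idx) n (F : 'I_n.*2 -> T) :
  \big[op/idx]_i F i = \big[op/idx]_(l < n) op (F (ev l)) (F (od l)).
Proof.
rewrite (reindex (@enc n)) /=; last by exists (@dec n) => ? _; rewrite (encK, decK).
transitivity (\big[op/idx]_(p : 'I_n * bool) F (enc (p.1, p.2))).
  by apply: eq_bigr => -[].
rewrite -(pair_bigA _ (fun l b => F (enc (l, b)))) /=.
by apply: eq_bigr => l _; rewrite big_bool Monoid.mulmC.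
Qed.

Variable F : numFieldType.
Implicit Types (n : nat).

(* [2 ^ n * n!] times the Pfaffian when [A] is skew-symmetric. *)
Definition Phi n (A : 'M[F]_n.*2) : F :=
  \sum_(s : 'S_n.*2) (-1) ^+ s * \prod_(l < n) A (s (ev l)) (s (od l)).

(** The analogue of Pf(B A B^T) = det B Pf A, proved like multiplicativity of the determinant: after
    expansion over families k, the sum over permutations is a determinant, zero for non-injective k
    and a signed det B otherwise. *)
Lemma Phi_congr n (A B : 'M[F]_n.*2) : Phi (B *m A *m B^T) = \det B * Phi A.
Proof.
pose G (s : 'S_n.*2) (l : 'I_n) (pq : 'I_n.*2 * 'I_n.*2) :=
  A pq.1 pq.2 * (B (s (ev l)) pq.1 * B (s (od l)) pq.2).
pose unc (k : {ffun 'I_n.*2 -> 'I_n.*2}) : {ffun 'I_n -> 'I_n.*2 * 'I_n.*2} :=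
  [ffun l => (k (ev l), k (od l))].
pose cur (k : {ffun 'I_n -> 'I_n.*2 * 'I_n.*2}) : {ffun 'I_n.*2 -> 'I_n.*2} :=
  [ffun i => if (dec i).2 then (k (dec i).1).2 else (k (dec i).1).1].
transitivity (\sum_(k : {ffun 'I_n.*2 -> 'I_n.*2}) \sum_(s : 'S_n.*2)
   (-1) ^+ s * \prod_l G s l (k (ev l), k (od l))).
  rewrite exchange_big /=; apply: eq_bigr => s _; rewrite -mulr_sumr; congr (_ * _).
  transitivity (\prod_(l < n) \sum_(pq : 'I_n.*2 * 'I_n.*2) G s l pq).
    apply: eq_bigr => l _; rewrite mxE.
    rewrite -(pair_bigA _ (fun p q => A p q * (B (s (ev l)) p * B (s (od l)) q))) exchange_big /=.
    apply: eq_bigr => q _; rewrite !mxE mulr_suml; apply: eq_bigr => p _.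
    by rewrite mulrCA mulrA.
  rewrite bigA_distr_bigA (reindex unc) /=.
    by apply: eq_bigr => k _; apply: eq_bigr => l _; rewrite ffunE.
  exists cur => k _; apply/ffunP => i; rewrite !ffunE.
    rewrite -[in RHS](decK i); case: (dec i) => l [] /=; rewrite ?ffunE//=.
  by rewrite /ev /od !encK /= -surjective_pairing.
transitivity (\sum_(k : {ffun 'I_n.*2 -> 'I_n.*2})
    (\prod_l A (k (ev l)) (k (od l))) * \det (\matrix_(i, j) B j (k i))).
  apply: eq_bigr => k _.
  rewrite /determinant mulr_sumr; apply: eq_bigr => s _.
  rewrite big_split /= mulrCA; congr (_ * (_ * _)).
  by rewrite big_enc; apply: eq_bigr => l _; rewrite !mxE.
rewrite (bigID (fun k : {ffun 'I_n.*2 -> 'I_n.*2} => injectiveb k)) /= addrC big1 ?add0r => [|k Uk].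
  rewrite (reindex (@pval _)) /=; last first.
    pose in_Sn := insubd (1%g : 'S_n.*2).
    by exists in_Sn => /= f Uf; first apply: val_inj; apply: insubdK.
  rewrite /Phi mulr_sumr; apply: eq_big => /= [s | s _]; rewrite ?(valP s)//.
  have -> : \matrix_(i, j) B j (pval s i) = (col_perm s B)^T.
    by apply/matrixP => i j; rewrite !mxE pvalE.
  rewrite det_tr col_permE det_mulmx det_perm odd_permV mulrC -mulrA; congr (_ * (_ * _)).
  by apply: eq_bigr => l _; rewrite !pvalE.
case/injectivePn: Uk => i1 [i2 Di12 Ef12].
by rewrite (determinant_alternate Di12) ?mulr0//= => j; rewrite !mxE Ef12.
Qed.

(* Pivoting on a nonzero entry [A i j] clears the rows and columns [i] and [j]. *)
Lemma skew_sum m n (A : 'I_m -> 'I_m -> F) (S : {set 'I_m}) :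
  (forall x y, A x y = - A y x) -> (forall x y, x \notin S -> A x y = 0) ->
  (#|S| <= n.*2)%N ->
  exists u v : nat -> 'I_m -> F, forall x y,
    A x y = \sum_(l < n) (u l x * v l y - v l x * u l y).
Proof.
elim: n A S => [|n ih] A S skA sA cS.
  exists (fun _ _ => 0), (fun _ _ => 0) => x y; rewrite big_ord0 sA//.
  by move: cS; rewrite leqn0 cards_eq0 => /eqP ->; rewrite inE.
have [/existsP[i /existsP[j Aij]]|A0] := boolP [exists i, exists j, A i j != 0]; last first.
  exists (fun _ _ => 0), (fun _ _ => 0) => x y; rewrite big1 => [|l _]; last by rewrite !mul0r subrr.
  apply/eqP; move: A0; rewrite negb_exists => /forallP /(_ x).
  by rewrite negb_exists => /forallP /(_ y); rewrite negbK.
have Axx x : A x x = 0.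
  by have := skA x x => /eqP; rewrite -subr_eq0 opprK -mulr2n mulrn_eq0/= => /eqP.
have ij : i != j by apply: contraNneq Aij => ->; rewrite Axx.
pose A' x y := A x y + (A x i * A j y - A x j * A i y) / A i j.
have [||| u [v A'E]] := ih A' (S :\ i :\ j)%SET.
- move=> x y; rewrite /A' (skA x y) (skA j y) (skA i y) (skA x i) (skA x j).
  by ring.
- move=> x y; rewrite !inE !negb_and !negbK => /or3P[/eqP ->|/eqP ->|xS].
  + by rewrite /A' Axx mul0r subr0 (skA j i) mulrAC mulNr mulfV// mulN1r subrr.
  + by rewrite /A' Axx mul0r sub0r mulNr mulrAC mulfV// mul1r subrr.
  + by rewrite /A' !(sA x)// !mul0r subrr mul0r addr0.
- have iS : i \in S by apply: contraNT Aij => iS; rewrite sA.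
  have jS : j \in S by apply: contraNT Aij => jS; rewrite skA sA// oppr0.
  have := cardsD1 i S; have := cardsD1 j (S :\ i)%SET.
  by rewrite !inE iS jS eq_sym ij /= => h1 h2; move: cS; rewrite h2 h1 doubleS.
exists (fun l => if l == n then (fun x => A x i / A i j) else u l),
       (fun l => if l == n then (fun x => A x j) else v l) => x y.
rewrite big_ord_recr /= eqxx.
under eq_bigr => l _ do rewrite (ltn_eqF (ltn_ord l)).
rewrite -A'E /A' (skA y j) (skA y i); field; exact: Aij.
Qed.

(** The block diagonal symplectic matrix with blocks (0, 1; -1, 0). *)
Definition Jmx n : 'M[F]_n.*2 :=
  \matrix_(p, q) ((p./2 == q./2)%:R * ((odd q)%:R - (odd p)%:R)).

(** The columns of B are the vectors u_l and v_l of [skew_sum]. B may be singular, so degenerate A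
    are covered too. *)
Lemma skew_normal_form n (A : 'M[F]_n.*2) : A^T = - A ->
  exists B : 'M[F]_n.*2, A = B *m Jmx n *m B^T.
Proof.
move=> skA.
have [|||u [v Auv]] := @skew_sum n.*2 n (fun x y => A x y) [set: 'I_n.*2]%SET.
- by move=> x y; have := congr1 (fun M : 'M[F]_(n.*2) => M y x) skA; rewrite !mxE.
- by move=> x y; rewrite inE.
- by rewrite cardsT card_ord.
exists (\matrix_(x, p) (if odd p then v p./2 x else u p./2 x)).
apply/matrixP => x y; rewrite Auv mxE.
have half_ev (l : 'I_n) : (ev l)./2 = l by rewrite /= addn0 doubleK.
have half_od (l : 'I_n) : (od l)./2 = l by rewrite /= addn1 /= uphalf_double.
have odd_ev (l : 'I_n) : odd (ev l) = false by rewrite /= addn0 odd_double.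
have odd_od (l : 'I_n) : odd (od l) = true by rewrite /= addn1 /= odd_double.
rewrite big_enc; apply: eq_bigr => l _; rewrite !mxE !big_enc.
rewrite half_ev half_od odd_ev odd_od.
rewrite (bigD1 l)//= big1 ?addr0; last first.
  move=> m ml; rewrite !mxE half_ev half_od half_ev (_ : (m == l :> nat) = false) ?mul0r ?mulr0 ?addr0//.
  exact/negbTE.
rewrite [X in _ + X * _](bigD1 l)//= big1 ?addr0; last first.
  move=> m ml; rewrite !mxE half_ev half_od half_od (_ : (m == l :> nat) = false) ?mul0r ?mulr0 ?addr0//.
  exact/negbTE.
rewrite /Jmx !mxE !half_ev !half_od !odd_ev !odd_od !eqxx /= !mulr1n; ring.
Qed.

(** In normal form [Phi] is det B times [Phi] of [Jmx], and the determinant is (det B)^2 times that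
    of [Jmx]; the constants cancel in the quotients. [S0] only witnesses that [Phi] of [Jmx] is
    nonzero, which spares its evaluation. *)
Lemma Phi_sqr_ratio n (A A0 S0 : 'M[F]_n.*2) : A^T = - A -> A0^T = - A0 -> S0^T = - S0 ->
  Phi S0 != 0 -> \det A0 != 0 ->
  Phi A0 != 0 /\ (Phi A / Phi A0) ^+ 2 = \det A / \det A0.
Proof.
move=> /skew_normal_form[B ->] /skew_normal_form[B0 ->] /skew_normal_form[C ->].
rewrite !Phi_congr !det_mulmx !det_tr !mulf_eq0 !negb_or -!andbA.
move=> /andP[_ J0] /and3P[b0 j0 _]; rewrite b0 J0; split => //.
by field; rewrite b0 J0 j0.
Qed.

Lemma sum_sign m i : (i <= m)%N ->
  \sum_(j < m) (-1) ^+ j * (if (j < i)%N then -1 else 1) = (odd m)%:R - 2 * (odd i)%:R :> F.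
Proof.
elim: m i => [|m ih] i.
  by rewrite leqn0 => /eqP ->; rewrite big_ord0 mulr0 subr0.
rewrite big_ord_recr /= leq_eqVlt => /predU1P[->|im].
  rewrite ltnSn (eq_bigr (fun j : 'I_m => (-1) ^+ j * (if (j < m)%N then -1 else 1))); last first.
    by move=> j _; rewrite ltn_ord ltnS ltnW.
  rewrite ih// -(signr_odd _ m) /=; case: (odd m) => /=; ring.
rewrite ih// ltnNge -ltnS im /= -(signr_odd _ m); case: (odd m) => /=; ring.
Qed.

(** The sign matrix of an increasing configuration of points. *)
Definition S0mx n : 'M[F]_n.*2 :=
  \matrix_(i, j) (if (i < j)%N then 1 else if (j < i)%N then -1 else 0).

(** Applied twice, this strips the first pair off the sum [Phi]. *)
Lemma big_perm_lift (T : Type) (idx : T) (op : Monoid.com_law idx) m (G : 'S_m.+1 -> T) :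
  \big[op/idx]_(s : 'S_m.+1) G s =
  \big[op/idx]_(j < m.+1) \big[op/idx]_(s : 'S_m) G (lift_perm ord0 j s).
Proof.
rewrite (partition_big (fun s : 'S_m.+1 => s ord0) predT) //=.
apply: eq_bigr => j _; rewrite (reindex (lift_perm ord0 j)).
  by apply: eq_bigl => s; rewrite lift_perm_id eqxx.
pose ulsf i (s : 'S_m.+1) k := odflt k (unlift (s i) (s (lift i k))).
have ulsfK i (s : 'S_m.+1) k : lift (s i) (ulsf i s k) = s (lift i k).
  rewrite /ulsf; have := neq_lift i k.
  by rewrite -(can_eq (permK s)) => /unlift_some[] ? ? ->.
have inj_ulsf : injective (ulsf ord0 _).
  move=> s; apply: can_inj (ulsf (s ord0) s^-1%g) _ => k'.
  by rewrite {1}/ulsf ulsfK !permK liftK.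
exists (fun s => perm (inj_ulsf s)) => [s _ | s].
  by apply/permP=> k'; rewrite permE /ulsf lift_perm_lift lift_perm_id liftK.
move/(s _ =P _) => si0; apply/permP=> k.
have [k'|->] := unliftP ord0 k; rewrite ?lift_perm_id //.
by move=> ->; rewrite lift_perm_lift permE -si0 ulsfK.
Qed.

(** Removing the images i and j of the first pair leaves the sign matrix of the remaining points. By
    [sum_sign] the sum over j equals (-1)^i, so each of the 2 n + 2 values of i contributes one copy
    of the smaller sum. *)
Lemma Phi_S0mx n : Phi (S0mx n) != 0.
Proof.
elim: n => [|n ih].
  rewrite /Phi (bigD1 1%g)//= [X in _ + X]big1 ?addr0 => [|s].
    by rewrite odd_perm1 expr0 big_ord0 mulr1 oner_eq0.
  by case/eqP; apply/permP => -[].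
suff -> : Phi (S0mx n.+1) = n.*2.+2%:R * Phi (S0mx n) by rewrite mulf_neq0// pnatr_eq0.
have Sl (m : nat) (i : 'I_m.+1) (j : 'I_m) : (i < lift i j)%N = (i <= j)%N /\ (lift i j < i)%N = (j < i)%N.
  by rewrite /lift /= /bump; case: (leqP i j) => h; lia.
rewrite {1}/Phi big_perm_lift.
transitivity (\sum_(i < n.*2.+2) \sum_(j < n.*2.+1)
   (-1) ^+ i * ((-1) ^+ j * (if (j < i)%N then -1 else 1)) * Phi (S0mx n)); last first.
  rewrite -[X in X%:R]card_ord -sum1_card natr_sum mulr_suml; apply: eq_bigr => i _.
  rewrite -mulr_suml -mulr_sumr sum_sign; last by rewrite -ltnS.
  rewrite /= odd_double /=.
  rewrite -(signr_odd _ i); case: (odd i) => /=; ring.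
apply: eq_bigr => i _; rewrite big_perm_lift; apply: eq_bigr => j _.
rewrite /Phi mulr_sumr; apply: eq_bigr => s _.
rewrite !odd_lift_perm !signr_addb /= !signr_odd expr0 !mul1r big_ord_recl /=.
have e0 : ev (ord0 : 'I_n.+1) = ord0 by exact: val_inj.
have e1 : od (ord0 : 'I_n.+1) = lift ord0 ord0 by exact: val_inj.
have eS (l : 'I_n) : ev (lift ord0 l : 'I_n.+1) = lift ord0 (lift ord0 (ev l)).
  by apply: val_inj; rewrite /= /bump /=; lia.
have oS (l : 'I_n) : od (lift ord0 l : 'I_n.+1) = lift ord0 (lift ord0 (od l)).
  by apply: val_inj; rewrite /= /bump /=; lia.
rewrite e0 e1 lift_perm_id lift_perm_lift lift_perm_id.
rewrite -!mulrA; congr (_ * _).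
have -> : S0mx n.+1 i (lift i j) = (if (j < i)%N then -1 else 1).
  by have [h1 h2] := Sl _ i j; rewrite mxE h1 h2 leqNgt; case: ltnP.
have -> : \prod_(l < n) S0mx n.+1 (lift_perm ord0 i (lift_perm ord0 j s) (ev (lift ord0 l)))
      (lift_perm ord0 i (lift_perm ord0 j s) (od (lift ord0 l))) =
    \prod_(l < n) S0mx n (s (ev l)) (s (od l)).
  have bumpE p q : (bump i (bump j p) < bump i (bump j q))%N = (p < q)%N.
    by rewrite /bump; lia.
  by apply: eq_bigr => l _; rewrite eS oS !lift_perm_lift !mxE /= !bumpE.
by congr (_ * _); rewrite [RHS]mulrCA; congr (_ * _); exact: mulrCA.
Qed.

Lemma S0mx_skew n : (S0mx n)^T = - S0mx n.
Proof.
by apply/matrixP => i j; rewrite !mxE; case: ltngtP => _; rewrite ?opprK ?oppr0.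
Qed.

End Phi.

(** * Signs of differences and the Vandermonde determinant *)

Section SignVandermonde.
Local Close Scope classical_set_scope.
Variables (F : realFieldType) (n : nat).
Implicit Types (x : 'I_n.*2 -> F).

Definition Smx x : 'M[F]_n.*2 := \matrix_(i, j) Num.sg (x j - x i).

Definition vander x : F := \det (Vandermonde n.*2 (\row_j x j)).

Lemma vanderE x : vander x = \prod_(i < n.*2) \prod_(j < n.*2 | (i < j)%N) (x j - x i).
Proof.
rewrite /vander det_Vandermonde; apply: eq_bigr => i _; apply: eq_bigr => j _.
by rewrite !mxE.
Qed.

Lemma sgr_prod (I : finType) (P : pred I) (G : I -> F) :
  Num.sg (\prod_(i | P i) G i) = \prod_(i | P i) Num.sg (G i).
Proof. by apply: (big_morph _ (@sgrM F)); exact: sgr1. Qed.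

(* Replacing the points by their ranks does not change any sign, so both
   sides reduce to the equally spaced configuration. *)
Lemma vander_Phi x : vander x * Phi (Smx x) = Phi (S0mx F n) * `|vander x|.
Proof.
have [/injectiveP xinj|/injectivePn[i1 [i2 n12 e12]]] := boolP (injectiveb x); last first.
  have -> : vander x = 0.
    rewrite /vander -det_tr; apply: (determinant_alternate n12) => j.
    by rewrite !mxE e12.
  by rewrite mul0r normr0 mulr0.
pose below i := finset (fun j => x j < x i).
have lt_r i : (#|below i| < n.*2)%N.
  rewrite -[X in (_ < X)%N]card_ord; apply: proper_card; apply/properP; split.
    exact/fintype.subsetP.
  by exists i => //; rewrite !inE ltxx.
pose r i := Ordinal (lt_r i).
have rlt i j : x i < x j -> (r i < r j)%N.
  move=> ij; apply: proper_card; apply/properP; split.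
    by apply/fintype.subsetP => k; rewrite !inE => /lt_trans; apply.
  by exists i; rewrite !inE ?ltxx.
have rinj : injective r.
  move=> i j rij; apply: xinj; case: (ltgtP (x i) (x j)) => // /rlt; rewrite rij ltnn//.
pose s := perm rinj.
have sgE i j : Num.sg (x j - x i) = Num.sg ((s j)%:R - (s i)%:R).
  rewrite !permE; case: (ltgtP (x i) (x j)) => [ij|ji|/xinj ->]; last by rewrite !subrr.
    by rewrite !gtr0_sg ?subr_gt0 ?ltr_nat// rlt.
  by rewrite !ltr0_sg ?subr_lt0 ?ltr_nat// rlt.
have PhiE : Phi (Smx x) = (-1) ^+ s * Phi (S0mx F n).
  rewrite /Phi mulr_sumr (reindex_inj (mulIg s^-1%g)) /=; apply: eq_bigr => t _.
  rewrite odd_permM odd_permV signr_addb -mulrA mulrCA; congr (_ * (_ * _)).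
  apply: eq_bigr => l _; rewrite !mxE sgE !permM !permKV.
  case: ltngtP => [h|h|/val_inj ->]; last by rewrite subrr sgr0.
    by rewrite gtr0_sg// subr_gt0 ltr_nat.
  by rewrite ltr0_sg// subr_lt0 ltr_nat.
have sgV : Num.sg (vander x) = (-1) ^+ s.
  transitivity (Num.sg (vander (fun i => (s i)%:R))).
    rewrite !vanderE !sgr_prod; apply: eq_bigr => i _; rewrite !sgr_prod.
    by apply: eq_bigr => j _; rewrite sgE.
  have -> : vander (fun i => (s i)%:R) = vander (fun i => i%:R) * (-1) ^+ s.
    rewrite /vander (_ : Vandermonde _ _ = col_perm s (Vandermonde n.*2 (\row_j j%:R))).
      by rewrite col_permE det_mulmx det_perm odd_permV.
    by apply/matrixP => i j; rewrite !mxE.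
  rewrite sgrM gtr0_sg ?mul1r; first by rewrite sgrX sgrN1.
  rewrite vanderE; apply: prodr_gt0 => i _; apply: prodr_gt0 => j ij.
  by rewrite subr_gt0 ltr_nat.
by rewrite PhiE normrEsg sgV mulrA mulrC (mulrC (vander x)).
Qed.

End SignVandermonde.

(** * Iterated integrals *)

Section IteratedIntegral.
Variable R : realType.
Implicit Types (rho : nat -> R) (l : seq nat) (F : (nat -> R) -> R).

Definition upd rho i x : nat -> R := fun k => if k == i then x else rho k.

(** Coordinates are named and integrated in the order of the list, the head outermost; in this form
    they can be split into groups. [nintgL] asks for integrability at every stage, for all values of
    the outer variables. *)
Fixpoint nintL l F rho : R :=
  if l is i :: l' then int11 (fun x => nintL l' F (upd rho i x)) else F rho.

Fixpoint nintgL l F rho : Prop :=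
  if l is i :: l' then
    intg (fun x => nintL l' F (upd rho i x)) /\ forall x, nintgL l' F (upd rho i x)
  else True.

Lemma nint_eq n (G H : seq R -> R) : (forall s, size s = n -> G s = H s) ->
  nint n G = nint n H.
Proof.
elim: n G H => [|n ih] G H GH /=; first exact: GH.
by congr int11; apply/funext => x; apply: ih => s sn; rewrite GH//= sn.
Qed.

Lemma nint_nintL n (G : seq R -> R) rho :
  nint n G = nintL (iota 0 n) (fun r => G (mkseq r n)) rho.
Proof.
(* Generalized over an offset m: the first m coordinates are frozen at their values in [rho]. *)
suff h m : nint n (fun s => G (mkseq rho m ++ s)) =
    nintL (iota m n) (fun r => G (mkseq r (m + n))) rho by have := h 0%N.
elim: n m rho => [|n ih] m rho /=; first by rewrite cats0 addn0.
congr int11; apply/funext => x; rewrite addnS -addSn -ih.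
congr nint; apply/funext => s; congr G.
rewrite -cat_rcons; congr (_ ++ _); rewrite /mkseq -[m.+1]addn1 iotaD map_cat cats1 /=.
rewrite add0n /upd eqxx; congr rcons; apply/eq_in_map => i; rewrite mem_iota add0n => im.
by rewrite ltn_eqF.
Qed.

Lemma nintL_sum (I : finType) l (c : I -> R) (G : I -> (nat -> R) -> R) rho :
  (forall t, nintgL l (G t) rho) ->
  nintL l (fun r => \sum_t c t * G t r) rho = \sum_t c t * nintL l (G t) rho.
Proof.
elim: l rho => [//|i l ih] rho iG /=.
transitivity (int11 (fun x => \sum_t c t * nintL l (G t) (upd rho i x))).
  congr int11; apply/funext => x; apply: ih => t; exact: (iG t).2.
rewrite int11_sum => [|t _]; last by apply: intgZ; exact: (iG t).1.
by apply: eq_bigr => t _; rewrite int11Z//; exact: (iG t).1.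
Qed.

Definition depends_on (A : pred nat) F :=
  forall r r', (forall i, A i -> r i = r' i) -> F r = F r'.

Lemma nintL_dep A l F r r' : depends_on A F -> (forall i, A i -> r i = r' i) ->
  nintL l F r = nintL l F r'.
Proof.
move=> dF; elim: l r r' => [|j l ih] r r' rr' /=; first exact: dF.
congr int11; apply/funext => x; apply: ih => i Ai; rewrite /upd.
by case: eqP => // _; exact: rr'.
Qed.

Lemma nintgL_dep A l F r r' : depends_on A F -> (forall i, A i -> r i = r' i) ->
  nintgL l F r -> nintgL l F r'.
Proof.
move=> dF; elim: l r r' => [//|j l ih] r r' rr' /= [i1 i2].
have ag x i : A i -> upd r j x i = upd r' j x i.
  by move=> Ai; rewrite /upd; case: eqP => // _; exact: rr'.
split; last by move=> x; apply: ih (i2 x); exact: ag.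
apply: intg_eq i1 => x _; apply: nintL_dep dF _; exact: ag.
Qed.

(** At each integration one of the factors does not involve the current variable and is pulled out.
    The order within each group is kept, so no integrals are exchanged. *)
Lemma nintL_sep A l F G rho : depends_on A F -> depends_on (predC A) G ->
  nintgL (seq.filter A l) F rho -> nintgL (seq.filter (predC A) l) G rho ->
  nintgL l (fun r => F r * G r) rho /\
  nintL l (fun r => F r * G r) rho =
    nintL (seq.filter A l) F rho * nintL (seq.filter (predC A) l) G rho.
Proof.
move=> dF dG; elim: l rho => [//|i l ih] rho.
case: (boolP (A i)) => Ai; rewrite /= ?Ai ?(negbTE Ai) /=.
  move=> [i1 i2] iG.
  have ag x k : predC A k -> rho k = upd rho i x k.
    by rewrite /upd /=; case: eqP => // ->; rewrite Ai.
  have h x := ih (upd rho i x) (i2 x) (nintgL_dep dG (ag x) iG).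
  have e x : nintL l (fun r => F r * G r) (upd rho i x) =
      nintL (seq.filter A l) F (upd rho i x) * nintL (seq.filter (predC A) l) G rho.
    by rewrite (h x).2 -(nintL_dep _ dG (ag x)).
  split; first split; last 1 first.
  - by rewrite -int11Zr//; congr int11; apply/funext.
  - by apply: intg_eq (intgZr _ i1) => x _; rewrite e.
  - by move=> x; exact: (h x).1.
move=> iF [i1 i2].
have ag x k : A k -> rho k = upd rho i x k.
  by rewrite /upd /=; case: eqP => // ->; rewrite (negbTE Ai).
have h x := ih (upd rho i x) (nintgL_dep dF (ag x) iF) (i2 x).
have e x : nintL l (fun r => F r * G r) (upd rho i x) =
    nintL (seq.filter A l) F rho * nintL (seq.filter (predC A) l) G (upd rho i x).
  by rewrite (h x).2 -(nintL_dep _ dF (ag x)).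
split; first split; last 1 first.
- by rewrite -int11Z//; congr int11; apply/funext.
- by apply: intg_eq (intgZ _ i1) => x _; rewrite e.
- by move=> x; exact: (h x).1.
Qed.

Lemma nintL_prod l (h : nat -> R -> R) rho : uniq l -> (forall i, intg (h i)) ->
  nintgL l (fun r => \prod_(i <- l) h i (r i)) rho /\
  nintL l (fun r => \prod_(i <- l) h i (r i)) rho = \prod_(i <- l) int11 (h i).
Proof.
move=> + ih; elim: l rho => [|i l IH] rho /=; first by rewrite !big_nil.
move=> /andP[il ul].
have f1 : seq.filter (pred1 i) (i :: l) = [:: i].
  rewrite /= eqxx; congr cons; apply/eqP; rewrite -(negbK (_ == _)) -has_filter.
  by apply/hasPn => j jl; apply: contraNneq il => <-.
have f2 : seq.filter (predC (pred1 i)) (i :: l) = l.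
  rewrite /= eqxx /=; apply/all_filterP/allP => j jl /=; apply: contraNneq il => <-//.
have d1 : depends_on (pred1 i) (fun r => h i (r i)) by move=> r r' rr' /=; rewrite rr'//=.
have d2 : depends_on (predC (pred1 i)) (fun r => \prod_(j <- l) h j (r j)).
  move=> r r' rr'; apply: eq_big_seq => j jl; rewrite rr'//=.
  by apply: contraNneq il => <-.
have [i2 e2] := IH rho ul.
have := @nintL_sep (pred1 i) (i :: l) _ _ rho d1 d2; rewrite f1 f2 e2.
have i1 : nintgL [:: i] (fun r => h i (r i)) rho.
  by split => //=; apply: intg_eq (ih i) => x _; rewrite /upd eqxx.
have -> : (fun r => \prod_(j <- i :: l) h j (r j)) = (fun r => h i (r i) * \prod_(j <- l) h j (r j)).
  by apply/funext => r; rewrite big_cons.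
move=> /(_ i1 i2)[j1 j2]; split; first exact: j1.
rewrite big_cons -[LHS]/(nintL (i :: l) _ rho) j2; congr (_ * _).
by rewrite /=; congr int11; apply/funext => x; rewrite /upd eqxx.
Qed.

(** Both iterated integrals exist and equal v; both are required since a permutation may put either
    member of a pair first. *)
Definition fubini2 (G : R -> R -> R) (v : R) :=
  [/\ forall x, intg (G x), intg (fun x => int11 (G x)), int11 (fun x => int11 (G x)) = v,
      forall y, intg (G^~ y) & intg (fun y => int11 (G^~ y)) /\ int11 (fun y => int11 (G^~ y)) = v].

Definition flat (c : seq (nat * nat)) : seq nat := flatten [seq [:: p.1; p.2] | p <- c].

Lemma nintL_pairs l (c : seq (nat * nat)) (G : nat * nat -> R -> R -> R) v rho :
  uniq l -> perm_eq l (flat c) -> (forall p, p \in c -> fubini2 (G p) (v p)) ->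
  nintgL l (fun r => \prod_(p <- c) G p (r p.1) (r p.2)) rho /\
  nintL l (fun r => \prod_(p <- c) G p (r p.1) (r p.2)) rho = \prod_(p <- c) v p.
Proof.
elim: c l rho => [|[i j] c IH] l rho ul lc fG.
  by have := perm_size lc => /= /size0nil ->; rewrite /= !big_nil.
pose A := [pred k | (k == i) || (k == j)].
have uc : uniq (i :: j :: flat c) by rewrite -(perm_uniq lc).
move: (uc); rewrite /= inE negb_or => /and3P[/andP[ij ic] jc ucc].
have notA k : k \in flat c -> ~~ A k.
  by move=> kc; rewrite /= negb_or; apply/andP; split; apply: contraTneq kc => ->.
have f1 : perm_eq (seq.filter A l) [:: i; j].
  rewrite (perm_trans (perm_filter _ lc))//= !eqxx orbT /=.
  suff -> : seq.filter A (flat c) = [::] by [].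
  by apply/eqP; rewrite -(negbK (_ == _)) -has_filter; apply/hasPn.
have f2 : perm_eq (seq.filter (predC A) l) (flat c).
  rewrite (perm_trans (perm_filter _ lc))//= !eqxx orbT /=.
  suff -> : seq.filter (predC A) (flat c) = flat c by [].
  by apply/all_filterP/allP.
have d1 : depends_on A (fun r => G (i, j) (r i) (r j)).
  by move=> r r' rr' /=; rewrite !rr'//= ?eqxx ?orbT.
have memc p : p \in c -> (p.1 \in flat c) /\ (p.2 \in flat c).
  by move=> pc; split; apply/flattenP; exists [:: p.1; p.2]; rewrite ?inE ?eqxx ?orbT//; apply/mapP; exists p.
have d2 : depends_on (predC A) (fun r => \prod_(p <- c) G p (r p.1) (r p.2)).
  move=> r r' rr'; apply: eq_big_seq => p /memc[p1 p2].
  by rewrite !rr'//=; exact: notA.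
have [|i2 e2] := IH (seq.filter (predC A) l) rho (filter_uniq _ ul) f2.
  by move=> p pc; apply: fG; rewrite inE pc orbT.
have [g1 g2 g3 g4 [g5 g6]] := fG (i, j) (mem_head _ _).
have [i1 e1] : nintgL (seq.filter A l) (fun r => G (i, j) (r i) (r j)) rho /\
    nintL (seq.filter A l) (fun r => G (i, j) (r i) (r j)) rho = v (i, j).
  (* The list fixes which of i and j is integrated first; each order uses one half of [fubini2]. *)
  have [->|->] : seq.filter A l = [:: i; j] \/ seq.filter A l = [:: j; i].
    have := perm_size f1; have := perm_mem f1; move: (filter_uniq A ul).
    case: (seq.filter A l) => [|x [|y [|]]]//= /andP[+ _] m _; rewrite inE => xy.
    have := m x; have := m y; rewrite !inE !eqxx !orbT /= => /esym/orP[]/eqP yE /esym/orP[]/eqP xE.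
    - by move: xy; rewrite xE yE eqxx.
    - by right; rewrite xE yE.
    - by left; rewrite xE yE.
    - by move: xy; rewrite xE yE eqxx.
  - have uE x y : upd (upd rho i x) j y i = x by rewrite /upd (negbTE ij) eqxx.
    have uE' x y : upd (upd rho i x) j y j = y by rewrite /upd eqxx.
    have e x : (fun y => G (i, j) (upd (upd rho i x) j y i) (upd (upd rho i x) j y j)) = G (i, j) x.
      by apply/funext => y; rewrite uE uE'.
    split; [split|]; rewrite /=.
    + by apply: intg_eq g2 => x _; rewrite e.
    + by move=> x; split => //; rewrite e.
    + by rewrite -g3; congr int11; apply/funext => x; rewrite e.
  - have uE x y : upd (upd rho j y) i x i = x by rewrite /upd eqxx.
    have uE' x y : upd (upd rho j y) i x j = y by rewrite /upd eq_sym (negbTE ij) eqxx.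
    have e y : (fun x => G (i, j) (upd (upd rho j y) i x i) (upd (upd rho j y) i x j)) = (G (i, j))^~ y.
      by apply/funext => x; rewrite uE uE'.
    split; [split|]; rewrite /=.
    + by apply: intg_eq g5 => x _; rewrite e.
    + by move=> x; split => //; rewrite e.
    + by rewrite -g6; congr int11; apply/funext => x; rewrite e.
have -> : (fun r => \prod_(p <- (i, j) :: c) G p (r p.1) (r p.2)) =
   (fun r => G (i, j) (r i) (r j) * \prod_(p <- c) G p (r p.1) (r p.2)).
  by apply/funext => r; rewrite big_cons.
have [j1 j2] := @nintL_sep A l _ _ rho d1 d2 i1 i2.
by split; rewrite // j2 e1 e2 big_cons.
Qed.

Lemma nint_prod n (h : 'I_n -> R -> R) rho : (forall i, intg (h i)) ->
  nintgL (iota 0 n) (fun r => \prod_(i < n) h i (r i)) rho /\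
  nintL (iota 0 n) (fun r => \prod_(i < n) h i (r i)) rho = \prod_(i < n) int11 (h i).
Proof.
move=> ih; pose h' (i : nat) := oapp h (fun=> 0) (insub i).
have h'E (i : 'I_n) : h' i = h i by rewrite /h' valK.
have ih' i : intg (h' i) by rewrite /h'; case: insubP => [i' _ _ | _] /=; [exact: ih|exact: intg0].
have [i1 e1] := nintL_prod rho (iota_uniq 0 n) ih'.
have bE (g : nat -> R) : \prod_(i <- iota 0 n) g i = \prod_(i < n) g i.
  by rewrite -(big_mkord xpredT) /index_iota subn0.
have fE : (fun r : nat -> R => \prod_(i < n) h i (r i)) =
    (fun r => \prod_(i <- iota 0 n) h' i (r i)).
  by apply/funext => r; rewrite bE; apply: eq_bigr => i _; rewrite h'E.
rewrite fE; split => //; rewrite e1 bE; apply: eq_bigr => i _; by rewrite h'E.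
Qed.

Lemma nint_det_finite_rank n r (p q : 'I_r -> R -> R) :
  (forall k j, intg (fun x => q k x * p j x)) ->
  nint n (fun s => \det (\matrix_(i < n, j < n) \sum_k p k s`_i * q k s`_j)) =
  \sum_(k : {ffun 'I_n -> 'I_r})
    \det (\matrix_(i < n, j < n) int11 (fun x => q (k i) x * p (k j) x)).
Proof.
move=> ipq; rewrite (nint_nintL _ _ (fun=> 0)).
(* In the term of k and s, the variable x_i occurs in the row factor p_{k i} and in the column
   factor q_{k (s^-1 i)}, so the integrand splits into functions of one variable. *)
pose h (t : {ffun 'I_n -> 'I_r} * 'S_n) (i : 'I_n) x := q (t.1 (t.2^-1%g i)) x * p (t.1 i) x.
have ih t i : intg (h t i) by exact: ipq.
transitivity (nintL (iota 0 n) (fun rho => \sum_(t : {ffun 'I_n -> 'I_r} * 'S_n) (-1) ^+ t.2 * \prod_(i < n) h t i (rho i)) (fun=> 0)).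
  congr nintL; apply/funext => rho.
  rewrite -(pair_bigA _ (fun k (s : 'S_n) => (-1) ^+ s * \prod_(i < n) h (k, s) i (rho i))) exchange_big /=.
  apply: eq_bigr => s _; rewrite -mulr_sumr; congr (_ * _).
  under eq_bigr => i _ do rewrite mxE !nth_mkseq//.
  rewrite bigA_distr_bigA /=; apply: eq_bigr => k _; rewrite /h !big_split /= mulrC.
  congr (_ * _); rewrite [RHS](reindex_inj (@perm_inj _ s)) /=.
  by apply: eq_bigr => i _; rewrite permK.
rewrite nintL_sum => [|t]; last by have [] := nint_prod (fun=> 0) (ih t).
rewrite -(pair_bigA _ (fun k (s : 'S_n) => (-1) ^+ s * nintL (iota 0 n) (fun rho => \prod_(i < n) h (k, s) i (rho i)) (fun=> 0))) /=.
apply: eq_bigr => k _; apply: eq_bigr => s _; congr (_ * _).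
have [_ ->] := nint_prod (fun=> 0) (ih (k, s)).
rewrite (reindex_inj (@perm_inj _ s)) /=; apply: eq_bigr => i _.
by rewrite mxE /h /= permK.
Qed.

(** The terms of order n > r vanish, so the partial sums are constant from r + 1 on, and the finite
    sum is the minor expansion of det (1 + B). *)
Lemma fredholm_det_finite_rank r (p q : 'I_r -> R -> R) :
  (forall k j, intg (fun x => q k x * p j x)) ->
  fredholm_det (fun x y => \sum_k p k x * q k y) =
  \det (1%:M + \matrix_(i, j) int11 (fun x => q i x * p j x)).
Proof.
move=> ipq; pose B : 'M[R]_r := \matrix_(i, j) int11 (fun x => q i x * p j x).
pose T n := n`!%:R^-1 * \sum_(k : {ffun 'I_n -> 'I_r}) \det (\matrix_(i, j) B (k i) (k j)).
rewrite /fredholm_det.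
have -> : (fun n : nat => n`!%:R^-1 * nint n (fun s =>
    \det (\matrix_(i < n, j < n) \sum_k p k s`_i * q k s`_j))) = T.
  apply/funext => n; rewrite nint_det_finite_rank//; congr (_ * _).
  apply: eq_bigr => k _; congr determinant; apply/matrixP => i j; by rewrite !mxE.
rewrite -det_one_plus_series; apply: cvg_lim => //.
apply: cvg_near_cst; exists r.+1 => // n /= rn.
rewrite /series /= -(subnKC rn) big_mkord big_split_ord /= [X in _ + X]big1 ?addr0//.
by move=> i _; rewrite /T sum_det_ffun_gt ?mulr0// addSn ltnS leq_addr.
Qed.

Lemma size_flat (c : seq (nat * nat)) : size (flat c) = (size c).*2.
Proof.
by elim: c => // p c ih; rewrite -[LHS]/((size (flat c)).+2) ih doubleS.
Qed.

Lemma flat_perm_iota n (s : 'S_n.*2) :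
  perm_eq (iota 0 n.*2) (flat [seq (val (s (ev i)), val (s (od i))) | i <- enum 'I_n]).
Proof.
rewrite perm_sym; apply: uniq_perm; last 2 first.
- exact: iota_uniq.
- move=> k; rewrite mem_iota add0n /=; apply/flattenP/idP => [[t]|kn].
    rewrite -map_comp => /mapP[i _ ->] /=; rewrite !inE => /orP[]/eqP ->; exact: ltn_ord.
  pose o := Ordinal kn; pose i := (s^-1%g o).
  exists [:: val (s (ev (dec i).1)); val (s (od (dec i).1))].
    by rewrite -map_comp; apply/mapP; exists (dec i).1; rewrite ?mem_enum.
  have : s (enc (dec i)) = o by rewrite decK /i permKV.
  by rewrite (surjective_pairing (dec i)); case: (dec i).2 => e; rewrite !inE /ev /od e eqxx ?orbT.
have szE : size (flat [seq (val (s (ev i)), val (s (od i))) | i <- enum 'I_n]) = n.*2.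
  by rewrite size_flat size_map size_enum_ord.
apply: (@leq_size_uniq _ (iota 0 n.*2)); first exact: iota_uniq.
  move=> k; rewrite mem_iota add0n /= => kn.
  pose o := Ordinal kn; pose i := (s^-1%g o); apply/flattenP.
  exists [:: val (s (ev (dec i).1)); val (s (od (dec i).1))].
    by rewrite -map_comp; apply/mapP; exists (dec i).1; rewrite ?mem_enum.
  have : s (enc (dec i)) = o by rewrite decK /i permKV.
  by rewrite (surjective_pairing (dec i)); case: (dec i).2 => e; rewrite !inE /ev /od e eqxx ?orbT.
by rewrite szE size_iota.
Qed.

Lemma sg_epsk (x y : R) : Num.sg (y - x) = - 2 * epsk x y.
Proof. by rewrite /epsk -opprB sgrN; field. Qed.

(** One order of integration gives -2 <g, eps h>, the other 2 <h, eps g>; skew-symmetry of eps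
    equates them, in place of a general Fubini theorem. *)
Lemma fubini2_sg (g h : R -> R) : cintg g -> cintg h ->
  fubini2 (fun x y => Num.sg (y - x) * (g x * h y)) (- 2 * int11 (fun x => g x * epsf h x)).
Proof.
move=> cg ch; have [ig _] := cg; have [ih _] := ch.
have igh : intg (fun x => g x * epsf h x) by apply: intgM_within => //; exact: epsf_within.
have ihg : intg (fun x => h x * epsf g x) by apply: intgM_within => //; exact: epsf_within.
have e1 x : (fun y => Num.sg (y - x) * (g x * h y)) = fun y => (- 2 * g x) * (epsk x y * h y).
  by apply/funext => y; rewrite sg_epsk; ring.
have e2 y : (fun x => Num.sg (y - x) * (g x * h y)) = fun x => (2 * h y) * (epsk y x * g x).
  by apply/funext => x; rewrite sg_epsk epskN; ring.
have v1 x : int11 (fun y => Num.sg (y - x) * (g x * h y)) = - 2 * (g x * epsf h x).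
  by rewrite e1 int11Z ?mulrA//; exact: intg_epsk.
have v2 y : int11 (fun x => Num.sg (y - x) * (g x * h y)) = 2 * (h y * epsf g y).
  by rewrite e2 int11Z ?mulrA//; exact: intg_epsk.
split => [x|||y|].
- by rewrite e1; apply: intgZ; exact: intg_epsk.
- by apply: intg_eq (intgZ (- 2) igh) => x _; rewrite v1.
- by rewrite -int11Z//; congr int11; apply/funext => x.
- by rewrite e2; apply: intgZ; exact: intg_epsk.
- split; first by apply: intg_eq (intgZ 2 ihg) => y _; rewrite v2.
  rewrite (int11_epsf_skew cg ch) mulNr mulrN opprK -int11Z//.
  by congr int11; apply/funext => y.
Qed.

(** Expanding [Phi] over s and the determinant over t, the integrand splits along the pairs matched
    by s, and each pair gives -2 times an entry. After the substitution s t for t, every s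
    contributes the same sum, whence the factorial. *)
Lemma de_Bruijn n (q : 'I_n.*2 -> R -> R) (c : R) : (forall j, cintg (q j)) ->
  nint n.*2 (fun s => c * (\det (\matrix_(i < n.*2, j < n.*2) q j s`_i) *
                      Phi (Smx (fun i : 'I_n.*2 => s`_i)))) =
  c * ((n.*2)`!%:R * (- 2) ^+ n *
    Phi (\matrix_(i < n.*2, j < n.*2) int11 (fun x => q i x * epsf (q j) x))).
Proof.
move=> cq; rewrite (nint_nintL _ _ (fun=> 0)).
pose A : 'M[R]_n.*2 := \matrix_(i < n.*2, j < n.*2) int11 (fun x => q i x * epsf (q j) x).
pose H (t : 'S_n.*2 * 'S_n.*2) (rho : nat -> R) := \prod_(i < n)
  (Num.sg (rho (t.1 (od i)) - rho (t.1 (ev i))) *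
    (q (t.2 (t.1 (ev i))) (rho (t.1 (ev i))) * q (t.2 (t.1 (od i))) (rho (t.1 (od i))))).
have HV t : nintgL (iota 0 n.*2) (H t) (fun=> 0) /\ nintL (iota 0 n.*2) (H t) (fun=> 0) =
    \prod_(i < n) (- 2 * A (t.2 (t.1 (ev i))) (t.2 (t.1 (od i)))).
  case: t => s t; pose q' (k : nat) := oapp (fun o => q (t o)) (fun=> 0) (insub k).
  have q'E (o : 'I_n.*2) : q' o = q (t o) by rewrite /q' valK.
  pose G (p : nat * nat) x y := Num.sg (y - x) * (q' p.1 x * q' p.2 y).
  pose cs := [seq (val (s (ev i)), val (s (od i))) | i <- enum 'I_n].
  have [|i1 e1] := @nintL_pairs _ cs G (fun p => - 2 * int11 (fun x => q' p.1 x * epsf (q' p.2) x))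
     (fun=> 0) (iota_uniq 0 n.*2) (flat_perm_iota s).
    move=> p /mapP[i _ ->]; rewrite /G /= !q'E; apply: fubini2_sg; exact: cq.
  have HE : H (s, t) = (fun r => \prod_(p <- cs) G p (r p.1) (r p.2)).
    apply/funext => rho; rewrite /H /cs big_map -big_enum /=; apply: eq_bigr => i _.
    by rewrite /G /= !q'E.
  rewrite HE; split => //; rewrite e1 big_map -big_enum /=; apply: eq_bigr => i _.
  by rewrite !q'E mxE.
transitivity (nintL (iota 0 n.*2)
   (fun rho => \sum_(t : 'S_n.*2 * 'S_n.*2) (c * ((-1) ^+ t.1 * (-1) ^+ t.2)) * H t rho) (fun=> 0)).
  congr nintL; apply/funext => rho.
  rewrite -(pair_bigA _ (fun s t : 'S_n.*2 => (c * ((-1) ^+ s * (-1) ^+ t)) * H (s, t) rho)) /=.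
  rewrite /Phi mulrA mulr_sumr; apply: eq_bigr => s _.
  rewrite /determinant mulr_sumr mulr_suml; apply: eq_bigr => t _.
  have -> : H (s, t) rho = (\prod_(i < n) Smx (fun i : 'I_n.*2 => (mkseq rho n.*2)`_i) (s (ev i)) (s (od i))) *
      \prod_i (\matrix_(i < n.*2, j < n.*2) q j (mkseq rho n.*2)`_i) i (t i).
    rewrite [X in _ * X](reindex_inj (@perm_inj _ s)) big_enc -big_split /=; apply: eq_bigr => i _.
    by rewrite !mxE !nth_mkseq.
  move: (\prod_(i < n) Smx _ _ _) (\prod_i _) ((-1) ^+ s : R) ((-1) ^+ t : R).
  by move=> S D es et; ring.
rewrite nintL_sum => [|t]; last by have [] := HV t.
rewrite -(pair_bigA _ (fun s t : 'S_n.*2 => (c * ((-1) ^+ s * (-1) ^+ t)) * nintL (iota 0 n.*2) (H (s, t)) (fun=> 0))) /=.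
transitivity (\sum_(s : 'S_n.*2) c * ((- 2) ^+ n * Phi A)); last first.
  rewrite sumr_const (_ : #|_| = (n.*2)`!); last exact: card_Sn.
  rewrite -mulr_natl.
  by rewrite -/A; move: (Phi A) => P; ring.
apply: eq_bigr => s _; rewrite /Phi !mulr_sumr [RHS](reindex_inj (mulgI s)) /=.
apply: eq_bigr => t _; have [_ ->] := HV (s, t); rewrite /= odd_permM signr_addb.
under [in RHS]eq_bigr => i _ do rewrite !permM.
rewrite big_split /= prodr_const card_ord.
by move: (\prod_(i < n) _) ((-1) ^+ s : R) ((-1) ^+ t : R) => P es et; ring.
Qed.

End IteratedIntegral.

(** * The two determinants *)

Section Assembly.
Variable R : realType.
Local Notation I11 := [set` `[(-1)%R : R, 1%R]].
Variables a b : R.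
Hypotheses (a2 : -2 < a) (b2 : -2 < b).
Local Notation phi := (phi1 a b).
Implicit Types (f : R -> R) (n : nat).

Definition skewmx n f : 'M[R]_n := \matrix_(i, j)
  int11 (fun x => phi i x * (1 + f x) * epsf (fun t => phi j t * (1 + f t)) x).

Lemma within_1p f : {within I11, continuous f} -> {within I11, continuous (fun x => 1 + f x)}.
Proof. by move=> cf x; apply: continuousD; [exact: cst_continuous|exact: cf]. Qed.

Lemma cintg_phi1p f j : {within I11, continuous f} -> cintg (fun x => phi j x * (1 + f x)).
Proof.
by move=> cf; apply: cintgM; [exact: within_1p|exact: cintg_phi].
Qed.

Lemma skewmx_tr n f : {within I11, continuous f} -> (skewmx n f)^T = - skewmx n f.
Proof.
move=> cf; apply/matrixP => i j; rewrite !mxE.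
by apply: int11_epsf_skew; exact: cintg_phi1p.
Qed.

Definition coefmx n : 'M[R]_n := \matrix_(m, j) (npol a b j)`_m.

Lemma det_coefmx n : \det (coefmx n) = \prod_(j < n) nlead a b j.
Proof.
rewrite -det_tr det_trig; last first.
  by apply/is_trig_mxP => i j ij; rewrite !mxE nth_default// size_npol.
by apply: eq_bigr => i _; rewrite !mxE coef_npol.
Qed.

Lemma det_npol n (x : 'I_n.*2 -> R) :
  \det (\matrix_(i, j) (npol a b j).[x i]) = \det (coefmx n.*2) * vander x.
Proof.
rewrite mulrC /vander -[X in X * _]det_tr -det_mulmx; congr determinant.
apply/matrixP => i j; rewrite !mxE (horner_coef_wide _ (n := n.*2)) ?size_npol//.
by apply: eq_bigr => m _; rewrite !mxE mulrC.
Qed.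

Lemma vdm_absE n (s : seq R) : size s = n.*2 ->
  vdm_abs s = `|vander (fun i : 'I_n.*2 => s`_i)|.
Proof.
move=> sn; rewrite /vdm_abs sn vanderE normr_prod; apply: eq_bigr => i _.
by rewrite normr_prod; apply: eq_bigr => j _; rewrite distrC.
Qed.

(** Independent of f, hence cancelled in G_N; what matters is that it is nonzero. *)
Definition JOEconst n : R :=
  (\det (coefmx n.*2) * Phi (S0mx R n))^-1 * ((n.*2)`!%:R * (- 2) ^+ n).

Lemma JOEconst_neq0 n : JOEconst n != 0.
Proof.
rewrite /JOEconst !mulf_neq0 ?invr_eq0 ?mulf_neq0 ?Phi_S0mx//.
- by rewrite det_coefmx; apply/prodf_neq0 => i _; rewrite gt_eqF// nlead_gt0.
- by rewrite expf_neq0// oppr_eq0 pnatr_eq0.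
Qed.

(** By [vander_Phi] the absolute Vandermonde product is, up to a constant, the signed one times
    [Phi] of the sign matrix. A triangular change of basis turns the signed one into the determinant
    of the p_j, whose rows absorb w (1 + f). *)
Lemma nint_JOE n f : {within I11, continuous f} ->
  nint n.*2 (fun s => vdm_abs s * \prod_(j < n.*2) (wJ a b s`_j * (1 + f s`_j))) =
  JOEconst n * Phi (skewmx n.*2 f).
Proof.
move=> cf; rewrite /JOEconst -mulrA.
rewrite -(de_Bruijn (q := fun (j : 'I_n.*2) x => phi j x * (1 + f x))); last first.
  by move=> j; exact: cintg_phi1p.
apply: nint_eq => s sn; rewrite (vdm_absE sn).
set x := fun i : 'I_n.*2 => s`_i.
have -> : \matrix_(i < n.*2, j < n.*2) (phi j s`_i * (1 + f s`_i)) =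
    diag_mx (\row_i (wJ a b (x i) * (1 + f (x i)))) *m (\matrix_(i, j) (npol a b j).[x i]).
  apply/matrixP => i j; rewrite mul_diag_mx !mxE phi_npol /wJ /jweight /x.
  by rewrite mulrAC.
rewrite det_mulmx det_diag det_npol.
have -> : \prod_i (\row_i (wJ a b (x i) * (1 + f (x i)))) 0 i =
    \prod_(j < n.*2) (wJ a b s`_j * (1 + f s`_j)).
  by apply: eq_bigr => i _; rewrite mxE.
have k0 : \det (coefmx n.*2) * Phi (S0mx R n) != 0.
  rewrite mulf_neq0 ?Phi_S0mx// det_coefmx.
  by apply/prodf_neq0 => i _; rewrite gt_eqF// nlead_gt0.
apply: (mulfI k0); rewrite mulVKf//.
have := vander_Phi x.
move: (\prod_(j < n.*2) _) (\det _) (Phi (S0mx R n)) (vander x) (Phi (Smx x)) `|vander x|.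
move=> P D K v S v' e.
transitivity (P * D * (K * v')); first by ring.
by rewrite -e; ring.
Qed.

Lemma GN1_sqr n f : {within I11, continuous f} -> \det (skewmx n.*2 (fun=> 0)) != 0 ->
  GN1 a b n.*2 f ^+ 2 = \det (skewmx n.*2 f) / \det (skewmx n.*2 (fun=> 0)).
Proof.
move=> cf d0.
have c0 : {within I11, continuous (fun=> 0 : R)} by apply: within_continuous => x; exact: cst_continuous.
have [P0 <-] := Phi_sqr_ratio (skewmx_tr n.*2 cf) (skewmx_tr n.*2 c0) (S0mx_skew R n)
   (Phi_S0mx R n) d0.
rewrite /GN1 nint_JOE//.
have -> : nint n.*2 (fun s => vdm_abs s * \prod_(j < n.*2) wJ a b s`_j) =
    JOEconst n * Phi (skewmx n.*2 (fun=> 0)).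
  rewrite -nint_JOE//; apply: nint_eq => s _; congr (_ * _).
  by apply: eq_bigr => j _; rewrite addr0 mulr1.
by rewrite -mulf_div divff ?JOEconst_neq0// mul1r.
Qed.

Lemma int11_epskr (g : R -> R) y : intg g -> int11 (fun z => g z * epsk z y) = - epsf g y.
Proof.
move=> ig; rewrite -int11N; last exact: intg_epsk.
by apply: int11_eq => z _; rewrite epskN; ring.
Qed.

Lemma epsfD (g h : R -> R) x : intg g -> intg h -> epsf (fun t => g t + h t) x = epsf g x + epsf h x.
Proof.
move=> ig ih; rewrite /epsf -int11D; [|exact: intg_epsk|exact: intg_epsk].
by apply: int11_eq => y _; rewrite mulrDr.
Qed.

Lemma epsf1p f j x : {within I11, continuous f} ->
  epsf (fun t => phi j t * (1 + f t)) x = epsf (phi j) x + epsf (fun t => phi j t * f t) x.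
Proof.
move=> cf; have [ip _] := cintg_phi a2 b2 j.
rewrite -epsfD//; last exact: intgM_within.
by congr epsf; apply/funext => t; rewrite mulrDr mulr1.
Qed.

Lemma within_sqr2 f : {within I11, continuous f} ->
  {within I11, continuous (fun y => f y ^+ 2 + 2 * f y)}.
Proof.
move=> cf; apply: (within_ext (F := fun y => f y * (1 + (1 + f y)))).
  by move=> x _; ring.
by apply: within_mul => //; do 2 apply: within_1p.
Qed.

Section Kernel.
Variables (N : nat) (f df : R -> R).
Hypotheses (cf : {within I11, continuous f}) (cdf : {within I11, continuous df}).
Hypotheses (dfE : forall x : R, -1 < x < 1 -> is_derive x 1 f (df x)).
Hypotheses (f1 : f 1 = 0) (fN1 : f (-1) = 0).

Definition lfac (j : 'I_N) x : R :=
  Fphi a b j x + (j == N.-1 :> nat)%:R * CN1 a b N * epsf (phi N) x.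

(** The terms of T_JOE that share the left factor of index j, gathered; the minus signs before eps
    f' turn to plus because eps is transposed onto phi_j. *)
Definition rfac (j : 'I_N) y : R :=
  phi j y * (f y ^+ 2 + 2 * f y) + df y * epsf (fun t => phi j t * (1 + f t)) y.

Lemma TJOE_finite_rank : (0 < N)%N ->
  TJOE a b N f df = fun x y => \sum_(j < N) lfac j x * rfac j y.
Proof.
move=> N0; apply/funext => x; apply/funext => y.
have ip j : intg (phi j) by have [] := cintg_phi a2 b2 j.
have ipf j : intg (fun t => phi j t * f t) by apply: intgM_within.
have e1 : Defs.kcomp (SN1 a b N) (@epsk R) x y = - \sum_(j < N) Fphi a b j x * epsf (phi j) y.
  rewrite /Defs.kcomp; transitivity (int11 (fun z => \sum_(j < N) Fphi a b j x * (phi j z * epsk z y))).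
    by apply: int11_eq => z _; rewrite /SN1 mulr_suml; apply: eq_bigr => j _; rewrite /Fphi; ring.
  have ie (j : 'I_N) : intg (fun z => phi j z * epsk z y).
    by apply: intg_eq (intgN (intg_epsk y (ip j))) => z _; rewrite epskN; ring.
  rewrite int11_sum => [|j _]; last exact: intgZ.
  rewrite -sumrN; apply: eq_bigr => j _; rewrite int11Z// int11_epskr// mulrN//.
have e2 : Defs.kcomp (kmulr (SN1 a b N) f) (@epsk R) x y =
    - \sum_(j < N) Fphi a b j x * epsf (fun t => phi j t * f t) y.
  rewrite /Defs.kcomp /kmulr; transitivity (int11 (fun z => \sum_(j < N) Fphi a b j x * (phi j z * f z * epsk z y))).
    by apply: int11_eq => z _; rewrite /SN1 !mulr_suml; apply: eq_bigr => j _; rewrite /Fphi; ring.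
  have ie (j : 'I_N) : intg (fun z => phi j z * f z * epsk z y).
    by apply: intg_eq (intgN (intg_epsk y (ipf j))) => z _; rewrite epskN; ring.
  rewrite int11_sum => [|j _]; last exact: intgZ.
  rewrite -sumrN; apply: eq_bigr => j _; rewrite int11Z// (int11_epskr (g := fun z => phi j z * f z))// mulrN//.
have e3 : Defs.kcomp (kmulr (tensor (epsf (phi N)) (phi N.-1)) f) (@epsk R) x y =
    - (epsf (phi N) x * epsf (fun t => phi N.-1 t * f t) y).
  rewrite /Defs.kcomp /kmulr /tensor -mulrN -int11_epskr// -int11Z; last first.
    by apply: intg_eq (intgN (intg_epsk y (ipf N.-1))) => z _; rewrite epskN; ring.
  by apply: int11_eq => z _; ring.
rewrite /TJOE; rewrite {1}/kmulr {1}/kmulr e1 {1}/kmulr e2 {1}/kmulr {1}/kmulr {1}/kmulr e3.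
have lt : (N.-1 < N)%N by rewrite prednK.
(* The three terms with C_N carry exactly the right factor of index N - 1, so they only modify that
   left factor and the rank stays N. *)
have -> : \sum_(j < N) lfac j x * rfac j y =
   \sum_(j < N) Fphi a b j x * rfac j y + CN1 a b N * epsf (phi N) x * rfac (Ordinal lt) y.
  have -> : CN1 a b N * epsf (phi N) x * rfac (Ordinal lt) y =
     \sum_(j < N) (j == N.-1 :> nat)%:R * CN1 a b N * epsf (phi N) x * rfac j y.
    rewrite [RHS](bigD1 (Ordinal lt))//= eqxx mul1r big1 ?addr0// => j jn.
    by rewrite (_ : (j == N.-1 :> nat) = false) ?mul0r//; apply/negbTE.
  by rewrite -big_split; apply: eq_bigr => j _; rewrite /lfac mulrDl.
have -> : \sum_(j < N) Fphi a b j x * rfac j y =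
   SN1 a b N x y * (f y ^+ 2 + 2 * f y) +
   (\sum_(j < N) Fphi a b j x * epsf (phi j) y) * df y +
   (\sum_(j < N) Fphi a b j x * epsf (fun t => phi j t * f t) y) * df y.
  rewrite /SN1 !mulr_suml -!big_split; apply: eq_bigr => j _ /=.
  by rewrite /rfac epsf1p// /Fphi; ring.
rewrite /rfac /= epsf1p// /tensor.
move: (\sum_(j < N) _) (\sum_(j < N) _) (SN1 _ _ _ _ _) (CN1 a b N) (epsf (phi N) x).
move: (epsf (phi N.-1) y) (epsf _ y) (phi N.-1 y) (f y) (df y) => *; ring.
Qed.

Lemma lfac_within j : {within I11, continuous (lfac j)}.
Proof.
move=> x; apply: continuousD; first exact: (Fphi_within a2 b2).
apply: continuousM; first exact: cst_continuous.
by apply: epsf_within; have [] := cintg_phi a2 b2 N.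
Qed.

Lemma intg_rfac j : intg (rfac j).
Proof.
apply: intgD.
  apply: intgM_within; last by have [] := cintg_phi a2 b2 j.
  exact: within_sqr2.
apply: intg_within; apply: within_mul => //.
by apply: epsf_within; have [] := cintg_phi1p j cf.
Qed.

Lemma epsf_df k x : x \in I11 ->
  epsf (fun t => df t * epsf (phi k) t) x = f x * epsf (phi k) x - epsf (fun t => phi k t * f t) x.
Proof.
move=> xI; have cp := cintg_phi a2 b2 k; have [ip _] := cp.
have ce := epsf_within ip.
have c1 : cintg (fun t => df t * epsf (phi k) t).
  split; first by apply: intg_within; exact: within_mul.
  by move=> y yI; apply: within_oo => //; exact: within_mul.
have c2 := cintgM cf cp.
have d (y : R) : -1 < y < 1 -> is_derive y 1 (fun t : R => f t * epsf (phi k) t)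
    (df y * epsf (phi k) y + phi k y * f y).
  move=> yI; apply: (is_derive_eq (is_derive_mul (dfE yI) (is_derive_epsf cp yI))).
  by rewrite [f y * _]mulrC.
have := epsf_FTC (cintgD c1 c2) (within_mul cf ce) d _ _ xI.
rewrite f1 fN1 !mul0r => /(_ erefl erefl).
rewrite epsfD; [|exact: c1.1|exact: c2.1].
by move=> <-; rewrite addrK.
Qed.

Lemma int11_rfac_epsf (i j : 'I_N) : int11 (fun x => rfac i x * epsf (phi j) x) =
  skewmx N f i j - skewmx N (fun=> 0) i j.
Proof.
have cp k := cintg_phi a2 b2 k; have ip k := (cp k).1.
have ce k : {within I11, continuous (epsf (phi k))} by apply: epsf_within; exact: ip.
have cq k := cintg_phi1p k cf; have iq k := (cq k).1.
have cq' k : {within I11, continuous (epsf (fun t => phi k t * (1 + f t)))}.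
  by apply: epsf_within; exact: iq.
have cD : cintg (fun t => df t * epsf (phi j) t).
  split; first by apply: intg_within; exact: within_mul.
  by move=> y yI; apply: within_oo => //; exact: within_mul.
have cg2 := within_sqr2 cf.
have i1 : intg (fun x => phi i x * (f x ^+ 2 + 2 * f x) * epsf (phi j) x).
  by apply: intgM_within; [exact: ce|apply: intgM_within; [exact: cg2|exact: ip]].
have i2 : intg (fun x => df x * epsf (phi j) x * epsf (fun t => phi i t * (1 + f t)) x).
  by apply: intgM_within; [exact: cq'|exact: cD.1].
transitivity (int11 (fun x => phi i x * (f x ^+ 2 + 2 * f x) * epsf (phi j) x +
    df x * epsf (phi j) x * epsf (fun t => phi i t * (1 + f t)) x)).
  by apply: int11_eq => x _; rewrite /rfac; ring.
(* Skewness moves eps onto f' eps phi_j, where [epsf_df] evaluates it. What remains is pointwise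
   algebra based on (f^2 + 2 f) - (1 + f) f = f. *)
rewrite (int11D i1 i2) (int11_epsf_skew cD (cq i)).
have i3 : intg (fun x => phi i x * (1 + f x) * epsf (fun t => df t * epsf (phi j) t) x).
  by apply: intgM_within; [apply: epsf_within; exact: cD.1|exact: iq].
rewrite -(int11B i1 i3) [skewmx N f i j]mxE [skewmx N _ i j]mxE.
have i4 : intg (fun x => phi i x * (1 + f x) * epsf (fun t => phi j t * (1 + f t)) x).
  by apply: intgM_within; [exact: cq'|exact: iq].
have p0 k : (fun t => phi k t * (1 + 0)) = phi k by apply/funext => t; rewrite addr0 mulr1.
rewrite p0; have i5 : intg (fun x => phi i x * (1 + 0) * epsf (phi j) x).
  by apply: intgM_within; [exact: ce|rewrite p0].
rewrite -(int11B i4 i5); apply: int11_eq => x xI.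
by rewrite epsf_df// epsf1p//; ring.
Qed.

Lemma fredholm_TJOE : (2 <= N)%N -> ~~ odd N ->
  \det (skewmx N (fun=> 0)) != 0 /\
  fredholm_det (TJOE a b N f df) = \det (skewmx N f) / \det (skewmx N (fun=> 0)).
Proof.
move=> N2 Neven.
have [c [cE dual]] := JOE_dual a2 b2 N2 Neven.
pose mu : 'M[R]_N := \matrix_(k, j) c j k.
have E0 (i j : 'I_N) : skewmx N (fun=> 0) i j = Eform a b i j.
  rewrite mxE /Eform; congr int11; apply/funext => x; rewrite addr0 mulr1; congr (_ * epsf _ _).
  by apply/funext => t; rewrite mulr1.
have M0mu : skewmx N (fun=> 0) *m mu = 1%:M.
  apply/matrixP => i j; rewrite !mxE -[RHS](dual i j)//.
  by apply: eq_bigr => k _; rewrite E0 mxE.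
have dd : \det (skewmx N (fun=> 0)) * \det mu = 1 by rewrite -det_mulmx M0mu det1.
have d0 : \det (skewmx N (fun=> 0)) != 0.
  by apply: contra_eq_neq dd => ->; rewrite mul0r eq_sym oner_neq0.
split => //; rewrite TJOE_finite_rank; last exact: ltnW.
have irl k j : intg (fun x => rfac k x * lfac j x).
  by apply: intgM_within; [exact: lfac_within|exact: intg_rfac].
rewrite fredholm_det_finite_rank//.
(* Writing the identity as M(0) mu, the Gram matrix (M(f) - M(0)) mu completes it to M(f) mu. *)
have -> : 1%:M + \matrix_(i, j) int11 (fun x => rfac i x * lfac j x) = skewmx N f *m mu.
  suff -> : \matrix_(i, j) int11 (fun x => rfac i x * lfac j x) =
      (skewmx N f - skewmx N (fun=> 0)) *m mu by rewrite -M0mu -mulmxDl addrC subrK.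
  apply/matrixP => i j; rewrite !mxE.
  have ie (k : 'I_N) : intg (fun x => rfac i x * epsf (phi k) x).
    apply: intgM_within; last exact: intg_rfac.
    by apply: epsf_within; have [] := cintg_phi a2 b2 k.
  transitivity (int11 (fun x => \sum_(k < N) c j k * (rfac i x * epsf (phi k) x))).
    apply: int11_eq => x xI; rewrite /lfac cE// mulr_sumr.
    by apply: eq_bigr => k _; rewrite mulrCA.
  rewrite int11_sum => [|k _]; last exact: intgZ.
  apply: eq_bigr => k _; rewrite (int11Z _ (ie k)) int11_rfac_epsf mulrC [mu k j]mxE.
  by congr (_ * _); rewrite [RHS]mxE; congr (_ + _); rewrite [RHS]mxE.
by rewrite det_mulmx; congr (_ * _); apply: (mulfI d0); rewrite dd divff.
Qed.

End Kernel.

End Assembly.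

Theorem theorem12 (R : realType) (a b : R) (N : nat) (f df : R -> R) :
  -2 < a -> -2 < b -> (2 <= N)%N -> ~~ odd N ->
  {within `[(-1)%R, 1%R], continuous f} ->
  {within `[(-1)%R, 1%R], continuous df} ->
  (forall x : R, -1 < x < 1 -> is_derive x 1 f (df x)) ->
  f (-1) = 0 -> f 1 = 0 ->
  (GN1 a b N f) ^+ 2 = fredholm_det (TJOE a b N f df).
Proof.
move=> a2 b2 N2 Neven cf cdf dfE fN1 f1.
have [d0 ->] := fredholm_TJOE a2 b2 cf cdf dfE f1 fN1 N2 Neven.
have NE : N = N./2.*2 by rewrite -[LHS](odd_double_half N) (negbTE Neven).
by move: d0; rewrite NE => d0; exact: GN1_sqr.
Qed.
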